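(* Let $(\mathcal S,\otimes_{\mathcal S})$ and $(\mathcal T,\otimes_{\mathcal T})$ be fusion categories over $\Bbbk$. Let $(\Gamma,\Gamma_{*,*},\Gamma_0):\mathcal S\to\mathcal T$ be a monoidal functor that preserves epimorphisms and such that the natural transformation $\Gamma_{*,*}$ is an epimorphism. If $S$ and $S'$ are Morita equivalent algebras in $\mathcal S$, then $\Gamma(S)$ and $\Gamma(S')$ are Morita equivalent algebras in $\mathcal T$.
   Context: $\Bbbk$ is an algebraically closed field of characteristic $0$. A fusion category is a $\Bbbk$-linear, abelian, semisimple, finite, rigid monoidal category whose unit object $\mathbf 1$ satisfies $\mathrm{End}(\mathbf 1)\cong\Bbbk$. A monoidal functor means a lax monoidal functor: a functor $\Gamma$ with a natural transformation $\Gamma_{X,X'}:\Gamma(X)\otimes_{\mathcal T}\Gamma(X')\to\Gamma(X\otimes_{\mathcal S}X')$ and a morphism $\Gamma_0:\mathbf 1_{\mathcal T}\to\Gamma(\mathbf 1_{\mathcal S})$ satisfying the usual associativity and unitality axioms; these are not required to be invertible. ''$\Gamma_{*,*}$ is an epimorphism'' means each $\Gamma_{X,X'}$ is an epimorphism. For an algebra $(S,m,u)$ in $\mathcal S$, $\Gamma(S)$ is the algebra $(\Gamma(S),\Gamma(m)\Gamma_{S,S},\Gamma(u)\Gamma_0)$ in $\mathcal T$. Two algebras $R,R'$ in a fusion category $\mathcal D$ are Morita equivalent if their categories of right modules $\mathcal D_R$ and $\mathcal D_{R'}$ in $\mathcal D$ are equivalent as left $\mathcal D$-module categories ($\mathcal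 D$ acting by tensoring on the left), i.e. via an equivalence $F$ with natural isomorphisms $F(X\otimes M)\cong X\otimes F(M)$ compatible with associativity and unit. *)

(* Defs.v *)
From mathcomp Require Import all_boot all_algebra boolp.

Set Implicit Arguments.
Unset Strict Implicit.
Unset Printing Implicit Defensive.

Import GRing.Theory.
Local Open Scope ring_scope.

Declare Scope cat_scope.
Delimit Scope cat_scope with cat.
Local Open Scope cat_scope.

Reserved Notation "X ⟶ Y" (at level 70, no associativity).
Reserved Notation "X ⟶ₖ Y" (at level 70, no associativity).
Reserved Notation "g ∘ f" (at level 40, left associativity).
Reserved Notation "X ⊗ Y" (at level 38, left associativity).
Reserved Notation "f ⊗₁ g" (at level 38, left associativity).
Reserved Notation "X ⊙ M" (at level 38, left associativity).
Reserved Notation "f ⊙₁ g" (at level 38, left associativity).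

Record category := Category {
  obj :> Type;
  hom : obj -> obj -> Type
    where "X ⟶ Y" := (hom X Y);
  idm : forall X : obj, X ⟶ X;
  comp : forall X Y Z : obj, Y ⟶ Z -> X ⟶ Y -> X ⟶ Z
    where "g ∘ f" := (comp g f);
  comp1m : forall (X Y : obj) (f : X ⟶ Y), idm Y ∘ f = f;
  compm1 : forall (X Y : obj) (f : X ⟶ Y), f ∘ idm X = f;
  compmA : forall (X Y Z W : obj) (h : Z ⟶ W) (g : Y ⟶ Z) (f : X ⟶ Y),
    h ∘ (g ∘ f) = h ∘ g ∘ f
}.
Arguments idm {c} X : rename.
Arguments comp {c X Y Z} g f : rename.
Arguments compmA {c X Y Z W} h g f : rename.
Notation "X ⟶ Y" := (hom X Y) : cat_scope.
Notation "g ∘ f" := (comp g f) : cat_scope.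

Section Morphisms.
Variable C : category.
Implicit Types X Y Z : C.

Definition is_mono X Y (f : X ⟶ Y) : Prop :=
  forall Z (g h : Z ⟶ X), f ∘ g = f ∘ h -> g = h.

Definition is_epi X Y (f : X ⟶ Y) : Prop :=
  forall Z (g h : Y ⟶ Z), g ∘ f = h ∘ f -> g = h.

Definition is_iso X Y (f : X ⟶ Y) : Prop :=
  exists g : Y ⟶ X, g ∘ f = idm X /\ f ∘ g = idm Y.

Definition isomorphic X Y : Prop := exists f : X ⟶ Y, is_iso f.

Definition is_zero_obj Z : Prop :=
  forall X, (exists! f : X ⟶ Z, True) /\ (exists! f : Z ⟶ X, True).

Definition is_projective P : Prop :=
  forall X Y (e : X ⟶ Y) (f : P ⟶ Y), is_epi e -> exists g : P ⟶ X, e ∘ g = f.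

End Morphisms.

Record functor (C D : category) := Functor {
  fobj :> C -> D;
  fmap : forall X Y : C, X ⟶ Y -> fobj X ⟶ fobj Y;
  fmap1 : forall X : C, fmap (idm X) = idm (fobj X);
  fmapM : forall (X Y Z : C) (g : Y ⟶ Z) (f : X ⟶ Y),
    fmap (g ∘ f) = fmap g ∘ fmap f
}.
Arguments fmap {C D} F {X Y} f : rename.

Definition preserves_epis (C D : category) (F : functor C D) : Prop :=
  forall (X Y : C) (f : X ⟶ Y), is_epi f -> is_epi (fmap F f).

Definition is_equivalence (C D : category) (F : functor C D) : Prop :=
  exists G : functor D C,
    (exists eta : forall X : C, X ⟶ G (F X),
       (forall X, is_iso (eta X)) /\
       (forall (X Y : C) (f : X ⟶ Y),
          eta Y ∘ f = fmap G (fmap F f) ∘ eta X)) /\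
    (exists eps : forall Y : D, F (G Y) ⟶ Y,
       (forall Y, is_iso (eps Y)) /\
       (forall (X Y : D) (f : X ⟶ Y),
          eps Y ∘ fmap F (fmap G f) = f ∘ eps X)).

Record monoidal_category := MonoidalCategory {
  mon_cat :> category;
  tunit : mon_cat;
  tensor : mon_cat -> mon_cat -> mon_cat
    where "X ⊗ Y" := (tensor X Y);
  tensor_hom : forall X X' Y Y' : mon_cat,
    X ⟶ X' -> Y ⟶ Y' -> X ⊗ Y ⟶ X' ⊗ Y'
    where "f ⊗₁ g" := (tensor_hom f g);
  associator : forall X Y Z : mon_cat, X ⊗ Y ⊗ Z ⟶ X ⊗ (Y ⊗ Z);
  associator_inv : forall X Y Z : mon_cat, X ⊗ (Y ⊗ Z) ⟶ X ⊗ Y ⊗ Z;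
  lunitor : forall X : mon_cat, tunit ⊗ X ⟶ X;
  lunitor_inv : forall X : mon_cat, X ⟶ tunit ⊗ X;
  runitor : forall X : mon_cat, X ⊗ tunit ⟶ X;
  runitor_inv : forall X : mon_cat, X ⟶ X ⊗ tunit;
  tensor1 : forall X Y : mon_cat, idm X ⊗₁ idm Y = idm (X ⊗ Y);
  tensorM : forall (X X' X'' Y Y' Y'' : mon_cat) (f' : X' ⟶ X'') (f : X ⟶ X')
    (g' : Y' ⟶ Y'') (g : Y ⟶ Y'),
    (f' ∘ f) ⊗₁ (g' ∘ g) = (f' ⊗₁ g') ∘ (f ⊗₁ g);
  associator_nat : forall (X X' Y Y' Z Z' : mon_cat)
    (f : X ⟶ X') (g : Y ⟶ Y') (h : Z ⟶ Z'),
    associator X' Y' Z' ∘ ((f ⊗₁ g) ⊗₁ h) =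
    (f ⊗₁ (g ⊗₁ h)) ∘ associator X Y Z;
  lunitor_nat : forall (X X' : mon_cat) (f : X ⟶ X'),
    lunitor X' ∘ (idm tunit ⊗₁ f) = f ∘ lunitor X;
  runitor_nat : forall (X X' : mon_cat) (f : X ⟶ X'),
    runitor X' ∘ (f ⊗₁ idm tunit) = f ∘ runitor X;
  associatorK : forall X Y Z : mon_cat,
    associator_inv X Y Z ∘ associator X Y Z = idm (X ⊗ Y ⊗ Z);
  associatorVK : forall X Y Z : mon_cat,
    associator X Y Z ∘ associator_inv X Y Z = idm (X ⊗ (Y ⊗ Z));
  lunitorK : forall X : mon_cat, lunitor_inv X ∘ lunitor X = idm (tunit ⊗ X);
  lunitorVK : forall X : mon_cat, lunitor X ∘ lunitor_inv X = idm X;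
  runitorK : forall X : mon_cat, runitor_inv X ∘ runitor X = idm (X ⊗ tunit);
  runitorVK : forall X : mon_cat, runitor X ∘ runitor_inv X = idm X;
  pentagon : forall W X Y Z : mon_cat,
    (idm W ⊗₁ associator X Y Z) ∘ associator W (X ⊗ Y) Z
      ∘ (associator W X Y ⊗₁ idm Z) =
    associator W X (Y ⊗ Z) ∘ associator (W ⊗ X) Y Z;
  triangle : forall X Y : mon_cat,
    (idm X ⊗₁ lunitor Y) ∘ associator X tunit Y = runitor X ⊗₁ idm Y
}.
Arguments tunit {m} : rename.
Notation "X ⊗ Y" := (tensor X Y) : cat_scope.
Notation "f ⊗₁ g" := (tensor_hom f g) : cat_scope.

Section MonoidalTheory.
Variable C : monoidal_category.
Implicit Types X Y Z : C.

(* [Xd] is a left dual of [X]; equivalently [X] is a right dual of [Xd]. *)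
Definition is_left_dual (Xd X : C) : Prop :=
  exists (ev : Xd ⊗ X ⟶ tunit) (coev : tunit ⟶ X ⊗ Xd),
    runitor X ∘ (idm X ⊗₁ ev) ∘ associator X Xd X
      ∘ (coev ⊗₁ idm X) ∘ lunitor_inv X = idm X /\
    lunitor Xd ∘ (ev ⊗₁ idm Xd) ∘ associator_inv Xd X Xd
      ∘ (idm Xd ⊗₁ coev) ∘ runitor_inv Xd = idm Xd.

Definition is_rigid : Prop :=
  forall X, (exists Xd, is_left_dual Xd X) /\ (exists dX, is_left_dual X dX).

Lemma tensor1M X Y Y' Y'' (g' : Y' ⟶ Y'') (g : Y ⟶ Y') :
  idm X ⊗₁ (g' ∘ g) = (idm X ⊗₁ g') ∘ (idm X ⊗₁ g).
Proof. by rewrite -tensorM comp1m. Qed.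

Lemma tensorM1 X Y Y' Y'' (g' : Y' ⟶ Y'') (g : Y ⟶ Y') :
  (g' ∘ g) ⊗₁ idm X = (g' ⊗₁ idm X) ∘ (g ⊗₁ idm X).
Proof. by rewrite -tensorM comp1m. Qed.

Lemma tensor_1l X X' Y Y' (f : X ⟶ X') (g : Y ⟶ Y') :
  (idm X' ⊗₁ g) ∘ (f ⊗₁ idm Y) = (f ⊗₁ idm Y') ∘ (idm X ⊗₁ g).
Proof. by rewrite -!tensorM !comp1m !compm1. Qed.

Lemma tunit_tensor_inj X Y (f g : X ⟶ Y) :
  idm tunit ⊗₁ f = idm tunit ⊗₁ g -> f = g.
Proof.
move=> e; have := congr1 (comp (lunitor Y)) e; rewrite !lunitor_nat.
by move/(congr1 (comp^~ (lunitor_inv X))); rewrite -!compmA lunitorVK !compm1.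
Qed.

Lemma tensor_tunit_inj X Y (f g : X ⟶ Y) :
  f ⊗₁ idm tunit = g ⊗₁ idm tunit -> f = g.
Proof.
move=> e; have := congr1 (comp (runitor Y)) e; rewrite !runitor_nat.
by move/(congr1 (comp^~ (runitor_inv X))); rewrite -!compmA runitorVK !compm1.
Qed.

Lemma associator_epi X Y Z : is_epi (associator X Y Z).
Proof.
move=> W g h /(congr1 (comp^~ (associator_inv X Y Z))).
by rewrite -!compmA associatorVK !compm1.
Qed.

Lemma associator_mono X Y Z : is_mono (associator X Y Z).
Proof.
move=> W g h /(congr1 (comp (associator_inv X Y Z))).
by rewrite !compmA associatorK !comp1m.
Qed.

Lemma associator1_epi X Y Z W : is_epi (associator X Y Z ⊗₁ idm W).
Proof.
move=> V g h /(congr1 (comp^~ (associator_inv X Y Z ⊗₁ idm W))).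
by rewrite -!compmA -tensorM1 associatorVK tensor1 !compm1.
Qed.

Lemma lunitor_tensor X Y :
  lunitor (X ⊗ Y) ∘ associator tunit X Y = lunitor X ⊗₁ idm Y.
Proof.
apply: tunit_tensor_inj; apply: associator_epi; apply: associator1_epi.
rewrite tensor1M -!compmA (compmA (idm tunit ⊗₁ associator _ _ _)) pentagon.
rewrite compmA triangle -tensor1 -associator_nat -triangle tensorM1.
by rewrite !compmA associator_nat.
Qed.

Lemma runitor_tensor X Y :
  (idm X ⊗₁ runitor Y) ∘ associator X Y tunit = runitor (X ⊗ Y).
Proof.
apply: tensor_tunit_inj; apply: associator_mono.
rewrite tensorM1 compmA associator_nat -!triangle tensor1M.
rewrite -!compmA (compmA (idm X ⊗₁ associator _ _ _)) pentagon.
by rewrite !compmA -associator_nat tensor1.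
Qed.

End MonoidalTheory.

Record lax_monoidal_functor (C D : monoidal_category) := LaxMonoidalFunctor {
  lax_functor :> functor C D;
  lax_mul : forall X Y : C,
    lax_functor X ⊗ lax_functor Y ⟶ lax_functor (X ⊗ Y);
  lax_unit : tunit ⟶ lax_functor tunit;
  lax_mul_nat : forall (X X' Y Y' : C) (f : X ⟶ X') (g : Y ⟶ Y'),
    lax_mul X' Y' ∘ (fmap lax_functor f ⊗₁ fmap lax_functor g) =
    fmap lax_functor (f ⊗₁ g) ∘ lax_mul X Y;
  lax_mulA : forall X Y Z : C,
    fmap lax_functor (associator X Y Z) ∘ lax_mul (X ⊗ Y) Z
      ∘ (lax_mul X Y ⊗₁ idm (lax_functor Z)) =
    lax_mul X (Y ⊗ Z) ∘ (idm (lax_functor X) ⊗₁ lax_mul Y Z)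
      ∘ associator (lax_functor X) (lax_functor Y) (lax_functor Z);
  lax_mul1m : forall X : C,
    fmap lax_functor (lunitor X) ∘ lax_mul tunit X
      ∘ (lax_unit ⊗₁ idm (lax_functor X)) = lunitor (lax_functor X);
  lax_mulm1 : forall X : C,
    fmap lax_functor (runitor X) ∘ lax_mul X tunit
      ∘ (idm (lax_functor X) ⊗₁ lax_unit) = runitor (lax_functor X)
}.

(* A [k]-module structure on every hom-set of [C]; [lhom L X Y] is the set
   [X ⟶ Y] seen as a [k]-module. *)
Definition hom_lmodule (k : fieldType) (C : category) :=
  forall X Y : C, GRing.Lmodule k (X ⟶ Y).

Definition lhom k C (L : hom_lmodule k C) (X Y : C) : lmodType k :=
  GRing.Lmodule.Pack (L X Y).

Section LinearNotions.
Variables (k : fieldType) (C : category) (L : hom_lmodule k C).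
Implicit Types X Y Z : C.
Local Notation "X ⟶ₖ Y" := (lhom L X Y) : cat_scope.

Definition is_linear_category : Prop :=
  (forall X Y Z (f : X ⟶ₖ Y), linear (fun g : Y ⟶ₖ Z => g ∘ f : X ⟶ₖ Z)) /\
  (forall X Y Z (g : Y ⟶ₖ Z), linear (fun f : X ⟶ₖ Y => g ∘ f : X ⟶ₖ Z)).

Definition is_kernel X Y (f : X ⟶ₖ Y) K (i : K ⟶ₖ X) : Prop :=
  f ∘ i = 0 :> (K ⟶ₖ Y) /\
  forall W (h : W ⟶ₖ X), f ∘ h = 0 :> (W ⟶ₖ Y) ->
    exists! u : W ⟶ₖ K, i ∘ u = h.

Definition is_cokernel X Y (f : X ⟶ₖ Y) Q (p : Y ⟶ₖ Q) : Prop :=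
  p ∘ f = 0 :> (X ⟶ₖ Q) /\
  forall W (h : Y ⟶ₖ W), h ∘ f = 0 :> (X ⟶ₖ W) ->
    exists! u : Q ⟶ₖ W, u ∘ p = h.

Definition is_direct_sum n (V : 'I_n -> C) X : Prop :=
  exists (i : forall a, V a ⟶ₖ X) (p : forall a, X ⟶ₖ V a),
    [/\ forall a, p a ∘ i a = idm (V a),
        forall a b, a != b -> p b ∘ i a = 0 :> (V a ⟶ₖ V b) &
        \sum_(a < n) (i a ∘ p a : X ⟶ₖ X) = idm X].

Definition is_abelian : Prop :=
  [/\ exists Z, is_zero_obj Z,
      forall V : 'I_2 -> C, exists X, is_direct_sum V X,
      forall X Y (f : X ⟶ₖ Y),
        (exists K (i : K ⟶ₖ X), is_kernel f i) /\
        (exists Q (p : Y ⟶ₖ Q), is_cokernel f p),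
      forall X Y (f : X ⟶ₖ Y), is_mono f ->
        exists Z (g : Y ⟶ₖ Z), is_kernel g f &
      forall X Y (f : X ⟶ₖ Y), is_epi f ->
        exists Z (g : Z ⟶ₖ X), is_cokernel g f].

Definition is_simple X : Prop :=
  ~ is_zero_obj X /\
  forall Y (i : Y ⟶ₖ X), is_mono i -> is_zero_obj Y \/ is_iso i.

Definition is_semisimple : Prop :=
  forall X, exists n (V : 'I_n -> C),
    (forall a, is_simple (V a)) /\ is_direct_sum V X.

(* A filtration of [X] by subobjects with simple subquotients. *)
Inductive has_finite_length : C -> Prop :=
| finite_length_zero X : is_zero_obj X -> has_finite_length X
| finite_length_ext X Y Q (i : Y ⟶ₖ X) (p : X ⟶ₖ Q) :
    is_mono i -> is_cokernel i p -> is_simple Q ->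
    has_finite_length Y -> has_finite_length X.

Definition is_finite_category : Prop :=
  [/\ forall X Y, exists n (b : 'I_n -> (X ⟶ₖ Y)),
        forall f, exists c : 'I_n -> k, f = \sum_(a < n) c a *: b a,
      forall X, has_finite_length X,
      forall X, exists P (e : P ⟶ₖ X), is_projective P /\ is_epi e &
      exists n (V : 'I_n -> C),
        forall X, is_simple X -> exists a, isomorphic X (V a)].

(* The endomorphism algebra of [X] is isomorphic to [k] as a [k]-algebra. *)
Definition has_trivial_End X : Prop :=
  exists phi : (X ⟶ₖ X) -> k,
    [/\ bijective phi,
        forall (a : k) (f g : X ⟶ₖ X), phi (a *: f + g) = a * phi f + phi g,
        phi (idm X) = 1 &
        forall f g : X ⟶ₖ X, phi (g ∘ f) = phi g * phi f].

End LinearNotions.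

Definition is_bilinear_tensor (k : fieldType) (C : monoidal_category)
    (L : hom_lmodule k C) : Prop :=
  (forall (X X' Y Y' : C) (g : Y ⟶ Y'),
     linear (fun f : lhom L X X' => f ⊗₁ g : lhom L (X ⊗ Y) (X' ⊗ Y'))) /\
  (forall (X X' Y Y' : C) (f : X ⟶ X'),
     linear (fun g : lhom L Y Y' => f ⊗₁ g : lhom L (X ⊗ Y) (X' ⊗ Y'))).

Record fusion_category (k : fieldType) := FusionCategory {
  fus_mon :> monoidal_category;
  fus_lmodule : hom_lmodule k fus_mon;
  fus_linear : is_linear_category fus_lmodule;
  fus_bilinear : is_bilinear_tensor fus_lmodule;
  fus_abelian : is_abelian fus_lmodule;
  fus_semisimple : is_semisimple fus_lmodule;
  fus_finite : is_finite_category fus_lmodule;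
  fus_rigid : is_rigid fus_mon;
  fus_unit : has_trivial_End fus_lmodule (tunit : fus_mon)
}.

Record module_category (D : monoidal_category) := ModuleCategory {
  modc_cat :> category;
  act : D -> modc_cat -> modc_cat
    where "X ⊙ M" := (act X M);
  act_hom : forall (X X' : D) (m m' : modc_cat),
    X ⟶ X' -> m ⟶ m' -> X ⊙ m ⟶ X' ⊙ m'
    where "f ⊙₁ g" := (act_hom f g);
  act_assoc : forall (X Y : D) (m : modc_cat), (X ⊗ Y) ⊙ m ⟶ X ⊙ (Y ⊙ m);
  act_unit : forall m : modc_cat, tunit ⊙ m ⟶ m;
  act1 : forall (X : D) (m : modc_cat), idm X ⊙₁ idm m = idm (X ⊙ m);
  actM : forall (X X' X'' : D) (m m' m'' : modc_cat) (f' : X' ⟶ X'') (f : X ⟶ X')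
    (g' : m' ⟶ m'') (g : m ⟶ m'),
    (f' ∘ f) ⊙₁ (g' ∘ g) = (f' ⊙₁ g') ∘ (f ⊙₁ g);
  act_assoc_nat : forall (X X' Y Y' : D) (m m' : modc_cat)
    (f : X ⟶ X') (g : Y ⟶ Y') (h : m ⟶ m'),
    act_assoc X' Y' m' ∘ ((f ⊗₁ g) ⊙₁ h) =
    (f ⊙₁ (g ⊙₁ h)) ∘ act_assoc X Y m;
  act_unit_nat : forall (m m' : modc_cat) (h : m ⟶ m'),
    act_unit m' ∘ (idm (tunit : D) ⊙₁ h) = h ∘ act_unit m;
  act_assoc_iso : forall (X Y : D) (m : modc_cat), is_iso (act_assoc X Y m);
  act_unit_iso : forall m : modc_cat, is_iso (act_unit m : (tunit : D) ⊙ m ⟶ m);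
  act_pentagon : forall (X Y Z : D) (m : modc_cat),
    (idm X ⊙₁ act_assoc Y Z m) ∘ act_assoc X (Y ⊗ Z) m
      ∘ (associator X Y Z ⊙₁ idm m) =
    act_assoc X Y (Z ⊙ m) ∘ act_assoc (X ⊗ Y) Z m;
  act_triangle : forall (X : D) (m : modc_cat),
    (idm X ⊙₁ act_unit m) ∘ act_assoc X tunit m = runitor X ⊙₁ idm m
}.
Notation "X ⊙ M" := (act X M) : cat_scope.
Notation "f ⊙₁ g" := (act_hom f g) : cat_scope.

Record module_functor (D : monoidal_category) (M N : module_category D) :=
  ModuleFunctor {
  mod_functor :> functor M N;
  mod_act : forall (X : D) (m : M), mod_functor (X ⊙ m) ⟶ X ⊙ mod_functor m;
  mod_act_iso : forall (X : D) (m : M), is_iso (mod_act X m);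
  mod_act_nat : forall (X X' : D) (m m' : M) (f : X ⟶ X') (g : m ⟶ m'),
    mod_act X' m' ∘ fmap mod_functor (f ⊙₁ g) =
    (f ⊙₁ fmap mod_functor g) ∘ mod_act X m;
  mod_act_assoc : forall (X Y : D) (m : M),
    (idm X ⊙₁ mod_act Y m) ∘ mod_act X (Y ⊙ m)
      ∘ fmap mod_functor (act_assoc X Y m) =
    act_assoc X Y (mod_functor m) ∘ mod_act (X ⊗ Y) m;
  mod_act_unit : forall m : M,
    act_unit (mod_functor m) ∘ mod_act tunit m = fmap mod_functor (act_unit m)
}.

Definition module_equivalent (D : monoidal_category) (M N : module_category D) :
    Prop :=
  exists F : module_functor M N, is_equivalence F.

Record algebra (D : monoidal_category) := Algebra {
  alg_obj :> D;
  alg_mul : alg_obj ⊗ alg_obj ⟶ alg_obj;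
  alg_unit : tunit ⟶ alg_obj;
  alg_mulA : alg_mul ∘ (alg_mul ⊗₁ idm alg_obj) =
    alg_mul ∘ (idm alg_obj ⊗₁ alg_mul) ∘ associator alg_obj alg_obj alg_obj;
  alg_mul1m : alg_mul ∘ (alg_unit ⊗₁ idm alg_obj) = lunitor alg_obj;
  alg_mulm1 : alg_mul ∘ (idm alg_obj ⊗₁ alg_unit) = runitor alg_obj
}.
Arguments alg_mul {D} A : rename.
Arguments alg_unit {D} A : rename.

Record right_module (D : monoidal_category) (A : algebra D) := RightModule {
  rmod_obj :> D;
  rmod_act : rmod_obj ⊗ A ⟶ rmod_obj;
  rmod_actA : rmod_act ∘ (rmod_act ⊗₁ idm (A : D)) =
    rmod_act ∘ (idm rmod_obj ⊗₁ alg_mul A) ∘ associator rmod_obj A A;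
  rmod_act1 : rmod_act ∘ (idm rmod_obj ⊗₁ alg_unit A) = runitor rmod_obj
}.
Arguments rmod_act {D A} M : rename.

Section RightModules.
Variables (D : monoidal_category) (A : algebra D).
Implicit Types M N P : right_module A.

Record rmod_hom M N := RmodHom {
  rmod_map :> (M : D) ⟶ (N : D);
  rmod_mapP : rmod_map ∘ rmod_act M = rmod_act N ∘ (rmod_map ⊗₁ idm (A : D))
}.

Lemma rmod_hom_eq M N (f g : rmod_hom M N) :
  rmod_map f = rmod_map g -> f = g.
Proof.
by case: f g => f fP [g gP] /= e; case: _ / e gP => gP; congr RmodHom;
  apply: Prop_irrelevance.
Qed.

Lemma rmod_idm_subproof M :
  idm (M : D) ∘ rmod_act M = rmod_act M ∘ (idm (M : D) ⊗₁ idm (A : D)).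
Proof. by rewrite tensor1 comp1m compm1. Qed.

Definition rmod_idm M : rmod_hom M M := RmodHom (rmod_idm_subproof M).

Lemma rmod_comp_subproof M N P (g : rmod_hom N P) (f : rmod_hom M N) :
  rmod_map g ∘ rmod_map f ∘ rmod_act M =
  rmod_act P ∘ ((rmod_map g ∘ rmod_map f) ⊗₁ idm (A : D)).
Proof. by rewrite -compmA rmod_mapP compmA rmod_mapP -compmA tensorM1. Qed.

Definition rmod_comp M N P (g : rmod_hom N P) (f : rmod_hom M N) :
  rmod_hom M P := RmodHom (rmod_comp_subproof g f).

Lemma rmod_comp1m M N (f : rmod_hom M N) : rmod_comp (rmod_idm N) f = f.
Proof. by apply: rmod_hom_eq; apply: comp1m. Qed.

Lemma rmod_compm1 M N (f : rmod_hom M N) : rmod_comp f (rmod_idm M) = f.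
Proof. by apply: rmod_hom_eq; apply: compm1. Qed.

Lemma rmod_compmA M N P Q (h : rmod_hom P Q) (g : rmod_hom N P)
    (f : rmod_hom M N) :
  rmod_comp h (rmod_comp g f) = rmod_comp (rmod_comp h g) f.
Proof. by apply: rmod_hom_eq; apply: compmA. Qed.

Definition rmod_cat : category :=
  Category rmod_comp1m rmod_compm1 rmod_compmA.

Section LeftTensor.
Variables (X : D) (M : right_module A).

Definition rtensor_act : X ⊗ M ⊗ A ⟶ X ⊗ M :=
  (idm X ⊗₁ rmod_act M) ∘ associator X M A.

Lemma rtensor_actA : rtensor_act ∘ (rtensor_act ⊗₁ idm (A : D)) =
  rtensor_act ∘ (idm (X ⊗ M) ⊗₁ alg_mul A) ∘ associator (X ⊗ M) A A.
Proof.
rewrite /rtensor_act tensorM1 -!compmA (compmA (associator X M A)).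
rewrite associator_nat !compmA -tensor1M rmod_actA !tensor1M -!compmA.
rewrite (compmA (idm X ⊗₁ associator _ _ _)) pentagon -tensor1.
by rewrite !(compmA _ _ (associator _ _ _)) -!compmA (compmA (associator _ _ _))
  associator_nat !compmA.
Qed.

Lemma rtensor_act1 :
  rtensor_act ∘ (idm (X ⊗ M) ⊗₁ alg_unit A) = runitor (X ⊗ M).
Proof.
rewrite /rtensor_act -compmA -tensor1 associator_nat compmA -tensor1M.
by rewrite rmod_act1 runitor_tensor.
Qed.

Definition rtensor : right_module A := RightModule rtensor_actA rtensor_act1.

End LeftTensor.

Lemma rtensor_hom_subproof (X X' : D) M M' (f : X ⟶ X') (g : rmod_hom M M') :
  (f ⊗₁ rmod_map g) ∘ rmod_act (rtensor X M) =
  rmod_act (rtensor X' M') ∘ ((f ⊗₁ rmod_map g) ⊗₁ idm (A : D)).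
Proof.
rewrite /= /rtensor_act -compmA associator_nat !compmA -!tensorM.
by rewrite compm1 comp1m rmod_mapP.
Qed.

Definition rtensor_hom (X X' : D) M M' (f : X ⟶ X') (g : rmod_hom M M') :
  rmod_hom (rtensor X M) (rtensor X' M') :=
  @RmodHom (rtensor X M) (rtensor X' M') _ (rtensor_hom_subproof f g).

Lemma rtensor_assoc_subproof (X Y : D) M :
  associator X Y M ∘ rmod_act (rtensor (X ⊗ Y) M) =
  rmod_act (rtensor X (rtensor Y M)) ∘ (associator X Y M ⊗₁ idm (A : D)).
Proof.
rewrite /= /rtensor_act compmA -tensor1 associator_nat -compmA -pentagon.
by rewrite /= /rtensor_act tensor1M !compmA.
Qed.

Definition rtensor_assoc (X Y : D) M :
  rmod_hom (rtensor (X ⊗ Y) M) (rtensor X (rtensor Y M)) :=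
  @RmodHom (rtensor (X ⊗ Y) M) (rtensor X (rtensor Y M)) _
    (rtensor_assoc_subproof X Y M).

Lemma rtensor_unit_subproof M :
  lunitor (M : D) ∘ rmod_act (rtensor tunit M) =
  rmod_act M ∘ (lunitor (M : D) ⊗₁ idm (A : D)).
Proof.
by rewrite /= /rtensor_act compmA lunitor_nat -compmA lunitor_tensor.
Qed.

Definition rtensor_unit M : rmod_hom (rtensor tunit M) M :=
  @RmodHom (rtensor tunit M) M _ (rtensor_unit_subproof M).

Lemma rmod_iso (M N : rmod_cat) (f : M ⟶ N) : is_iso (rmod_map f) -> is_iso f.
Proof.
case=> g [gf fg].
have gP : g ∘ rmod_act N = rmod_act M ∘ (g ⊗₁ idm (A : D)).
  rewrite -[LHS]compm1 -tensor1 -fg tensorM1 compmA -(compmA g) -rmod_mapP.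
  by rewrite !compmA gf comp1m.
by exists (RmodHom gP); split; apply: rmod_hom_eq.
Qed.

Lemma rtensor_assoc_iso (X Y : D) M :
  is_iso (rtensor_assoc X Y M : hom (c := rmod_cat) _ _).
Proof.
apply: rmod_iso; exists (associator_inv X Y M).
by split; [apply: associatorK | apply: associatorVK].
Qed.

Lemma rtensor_unit_iso M : is_iso (rtensor_unit M : hom (c := rmod_cat) _ _).
Proof.
apply: rmod_iso; exists (lunitor_inv (M : D)).
by split; [apply: lunitorK | apply: lunitorVK].
Qed.

Lemma rtensor1 (X : D) M :
  rtensor_hom (idm X) (rmod_idm M) = rmod_idm (rtensor X M).
Proof. by apply: rmod_hom_eq; apply: tensor1. Qed.

Lemma rtensorM (X X' X'' : D) M M' M'' (f' : X' ⟶ X'') (f : X ⟶ X')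
    (g' : rmod_hom M' M'') (g : rmod_hom M M') :
  rtensor_hom (f' ∘ f) (rmod_comp g' g) =
  rmod_comp (rtensor_hom f' g') (rtensor_hom f g).
Proof. by apply: rmod_hom_eq; apply: tensorM. Qed.

Lemma rtensor_assoc_nat (X X' Y Y' : D) M M' (f : X ⟶ X') (g : Y ⟶ Y')
    (h : rmod_hom M M') :
  rmod_comp (rtensor_assoc X' Y' M') (rtensor_hom (f ⊗₁ g) h) =
  rmod_comp (rtensor_hom f (rtensor_hom g h)) (rtensor_assoc X Y M).
Proof. by apply: rmod_hom_eq; apply: associator_nat. Qed.

Lemma rtensor_unit_nat M M' (h : rmod_hom M M') :
  rmod_comp (rtensor_unit M') (rtensor_hom (idm tunit) h) =
  rmod_comp h (rtensor_unit M).
Proof. by apply: rmod_hom_eq; apply: lunitor_nat. Qed.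

Lemma rtensor_pentagon (X Y Z : D) M :
  rmod_comp
    (rmod_comp (rtensor_hom (idm X) (rtensor_assoc Y Z M))
       (rtensor_assoc X (Y ⊗ Z) M))
    (rtensor_hom (associator X Y Z) (rmod_idm M)) =
  rmod_comp (rtensor_assoc X Y (rtensor Z M)) (rtensor_assoc (X ⊗ Y) Z M).
Proof. by apply: rmod_hom_eq; apply: pentagon. Qed.

Lemma rtensor_triangle (X : D) M :
  rmod_comp (rtensor_hom (idm X) (rtensor_unit M)) (rtensor_assoc X tunit M) =
  rtensor_hom (runitor X) (rmod_idm M).
Proof. by apply: rmod_hom_eq; apply: triangle. Qed.

Definition rmod_modcat : module_category D :=
  @ModuleCategory D rmod_cat rtensor rtensor_hom rtensor_assoc rtensor_unit
    rtensor1 rtensorM rtensor_assoc_nat rtensor_unit_nat rtensor_assoc_iso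
    rtensor_unit_iso rtensor_pentagon rtensor_triangle.

End RightModules.

Definition morita_equivalent (D : monoidal_category) (A B : algebra D) : Prop :=
  module_equivalent (rmod_modcat A) (rmod_modcat B).

Section LaxAlgebra.
Variables (C D : monoidal_category) (F : lax_monoidal_functor C D).
Variable A : algebra C.

Definition lax_alg_mul : F A ⊗ F A ⟶ F A := fmap F (alg_mul A) ∘ lax_mul F A A.

Definition lax_alg_unit : tunit ⟶ F A := fmap F (alg_unit A) ∘ lax_unit F.

Lemma lax_alg_mulA : lax_alg_mul ∘ (lax_alg_mul ⊗₁ idm (F A)) =
  lax_alg_mul ∘ (idm (F A) ⊗₁ lax_alg_mul) ∘ associator (F A) (F A) (F A).
Proof.
rewrite /lax_alg_mul tensorM1 tensor1M -!compmA -fmap1.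
rewrite !(compmA (lax_mul F A A)) !lax_mul_nat -!compmA !fmap1.
rewrite (compmA (lax_mul F A (A ⊗ A))) -lax_mulA !compmA -!fmapM.
by rewrite alg_mulA.
Qed.

Lemma lax_alg_mul1m : lax_alg_mul ∘ (lax_alg_unit ⊗₁ idm (F A)) = lunitor (F A).
Proof.
rewrite /lax_alg_mul /lax_alg_unit tensorM1 -fmap1 -!compmA.
rewrite (compmA (lax_mul F A A)) lax_mul_nat !compmA -fmapM alg_mul1m fmap1.
exact: lax_mul1m.
Qed.

Lemma lax_alg_mulm1 : lax_alg_mul ∘ (idm (F A) ⊗₁ lax_alg_unit) = runitor (F A).
Proof.
rewrite /lax_alg_mul /lax_alg_unit tensor1M -fmap1 -!compmA.
rewrite (compmA (lax_mul F A A)) lax_mul_nat !compmA -fmapM alg_mulm1 fmap1.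
exact: lax_mulm1.
Qed.

Definition lax_algebra : algebra D :=
  Algebra lax_alg_mulA lax_alg_mul1m lax_alg_mulm1.

End LaxAlgebra.

(* Main.v *)
(* An equivalence F of left module categories S_A -> S_A' turns the regular
   modules of A and A' into objects of S_A' related by a Morita context: with
   F(Q) isomorphic to A', the internal homs between F(A) and A' form a category
   enriched in S with two objects, whose endomorphism algebras are A and A' and
   whose hom objects are P = F(A) and Q.  The two compositions
   P ⊗ Q -> A and Q ⊗ P -> A' are epimorphisms of modules, hence (everything in S
   being split) epimorphisms of S.  A lax monoidal functor carries enriched
   categories to enriched categories, and the hypotheses on Gamma keep these two
   compositions epimorphic.

   Conversely let E be enriched in T with all compositions E i j ⊗ E j i -> E i i
   epimorphic.  As the unit of T is projective, the units of E lift along them, and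
   such lifts make evaluation at any object i an equivalence from E-modules to
   modules over the algebra E i i: every E-module M is a split coequalizer of free
   modules on M i.  Two such evaluations form a span of module equivalences. *)
From mathcomp Require Import all_boot all_algebra boolp.
Require Import Defs.

Set Implicit Arguments.
Unset Strict Implicit.
Unset Printing Implicit Defensive.

Import GRing.Theory.
Local Open Scope cat_scope.

(** * Weak equivalences of module categories *)

Section CategoryTheory.
Variable C : category.
Implicit Types X Y Z W : C.

Lemma reassoc X Y Z W (g : Y ⟶ Z) (f : X ⟶ Y) (r : X ⟶ Z) (z : W ⟶ X) :
  g ∘ f = r -> g ∘ (f ∘ z) = r ∘ z.
Proof. by rewrite compmA => ->. Qed.

Definition iso_inv X Y (f : X ⟶ Y) (f_iso : is_iso f) : Y ⟶ X := sval (cid f_iso).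

Lemma iso_invK X Y (f : X ⟶ Y) (f_iso : is_iso f) : iso_inv f_iso ∘ f = idm X.
Proof. by rewrite /iso_inv; case: cid => g []. Qed.

Lemma iso_invVK X Y (f : X ⟶ Y) (f_iso : is_iso f) : f ∘ iso_inv f_iso = idm Y.
Proof. by rewrite /iso_inv; case: cid => g []. Qed.

Lemma iso_inv_iso X Y (f : X ⟶ Y) (f_iso : is_iso f) : is_iso (iso_inv f_iso).
Proof. by exists f; rewrite iso_invK iso_invVK. Qed.

Lemma is_iso_comp X Y Z (g : Y ⟶ Z) (f : X ⟶ Y) :
  is_iso g -> is_iso f -> is_iso (g ∘ f).
Proof.
case=> g' [g'g gg'] [f' [f'f ff']]; exists (f' ∘ g').
by rewrite -!compmA (reassoc _ g'g) (reassoc _ ff') !comp1m.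
Qed.

Lemma is_iso_id X : is_iso (idm X).
Proof. by exists (idm X); rewrite comp1m. Qed.

Lemma split_epi X Y (p : X ⟶ Y) (s : Y ⟶ X) : p ∘ s = idm Y -> is_epi p.
Proof.
move=> ps Z g h /(congr1 (comp^~ s)).
by rewrite -!compmA ps !compm1.
Qed.

Lemma split_mono X Y (s : X ⟶ Y) (r : Y ⟶ X) : r ∘ s = idm X -> is_mono s.
Proof.
move=> rs Z g h /(congr1 (comp r)).
by rewrite !compmA rs !comp1m.
Qed.

Lemma iso_epi X Y (f : X ⟶ Y) : is_iso f -> is_epi f.
Proof. by case=> g [_ /split_epi]. Qed.

Lemma iso_mono X Y (f : X ⟶ Y) : is_iso f -> is_mono f.
Proof. by case=> g [/split_mono]. Qed.

Lemma is_epi_comp X Y Z (g : Y ⟶ Z) (f : X ⟶ Y) :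
  is_epi g -> is_epi f -> is_epi (g ∘ f).
Proof. by move=> g_epi f_epi W a b; rewrite !compmA => /f_epi/g_epi. Qed.

End CategoryTheory.

Section WeakEquivalence.
Variables C D : category.

Definition fully_faithful (F : functor C D) : Prop :=
  forall (X Y : C) (h : F X ⟶ F Y), exists! f : X ⟶ Y, fmap F f = h.

Definition essentially_surjective (F : functor C D) : Prop :=
  forall Y : D, exists X (f : F X ⟶ Y), is_iso f.

Definition weak_equivalence (F : functor C D) : Prop :=
  fully_faithful F /\ essentially_surjective F.

Lemma ff_faithful (F : functor C D) (ff : fully_faithful F) (X Y : C) (f g : X ⟶ Y) :
  fmap F f = fmap F g -> f = g.
Proof.
move=> e; have [h [_ h_uniq]] := ff _ _ (fmap F f).
by rewrite -(h_uniq f) // -(h_uniq g).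
Qed.

Definition ff_lift (F : functor C D) (ff : fully_faithful F) X Y (h : F X ⟶ F Y) :
  X ⟶ Y := sval (cid (ff X Y h)).

Lemma ff_liftK (F : functor C D) (ff : fully_faithful F) X Y (h : F X ⟶ F Y) :
  fmap F (ff_lift ff h) = h.
Proof. by rewrite /ff_lift; case: cid => f []. Qed.

Lemma fmap_iso (F : functor C D) X Y (f : X ⟶ Y) : is_iso f -> is_iso (fmap F f).
Proof. by case=> g [gf fg]; exists (fmap F g); rewrite -!fmapM gf fg !fmap1. Qed.

Lemma ff_reflects_iso (F : functor C D) (ff : fully_faithful F) X Y (f : X ⟶ Y) :
  is_iso (fmap F f) -> is_iso f.
Proof.
case=> g [gf fg]; exists (ff_lift ff g).
by split; apply: (ff_faithful ff); rewrite fmapM fmap1 ff_liftK.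
Qed.

(** The data contain no triangle identities. The preimage of [h] is [fmap G h] conjugated by [eta],
    which is verified after applying [G], faithful because of [eps]. *)
Lemma equivalence_weak (F : functor C D) : is_equivalence F -> weak_equivalence F.
Proof.
case=> G [[eta [eta_iso eta_nat]] [eps [eps_iso eps_nat]]].
have faithfulF X Y (f g : X ⟶ Y) : fmap F f = fmap F g -> f = g.
  by move=> e; apply: (iso_mono (eta_iso Y)); rewrite !eta_nat e.
have faithfulG X Y (f g : X ⟶ Y) : fmap G f = fmap G g -> f = g.
  by move=> e; apply: (iso_epi (eps_iso X)); rewrite -!eps_nat e.
split=> [X Y h|Y]; last by exists (G Y), (eps Y).
exists (iso_inv (eta_iso Y) ∘ fmap G h ∘ eta X); split; last first.
  by move=> f <-; rewrite -compmA -eta_nat compmA iso_invK comp1m.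
apply: faithfulG; apply: (iso_epi (eta_iso X)).
by rewrite -eta_nat !compmA iso_invVK comp1m.
Qed.

End WeakEquivalence.

(** * The quasi-inverse of a weak equivalence *)

Section Inverse.
Variables (C D : category) (F : functor C D).
Hypotheses (ff : fully_faithful F) (es : essentially_surjective F).

Definition inv_obj (Y : D) : C := sval (cid (es Y)).
Definition inv_counit (Y : D) : F (inv_obj Y) ⟶ Y := sval (cid (svalP (cid (es Y)))).
Lemma inv_counit_iso Y : is_iso (inv_counit Y).
Proof. exact: svalP (cid (svalP (cid (es Y)))). Qed.

Definition inv_map Y Z (f : Y ⟶ Z) : inv_obj Y ⟶ inv_obj Z :=
  ff_lift ff (iso_inv (inv_counit_iso Z) ∘ f ∘ inv_counit Y).

Lemma inv_counit_nat Y Z (f : Y ⟶ Z) :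
  inv_counit Z ∘ fmap F (inv_map f) = f ∘ inv_counit Y.
Proof. by rewrite ff_liftK !compmA iso_invVK comp1m. Qed.

Lemma inv_hom_eq X Y (f g : X ⟶ inv_obj Y) :
  inv_counit Y ∘ fmap F f = inv_counit Y ∘ fmap F g -> f = g.
Proof. by move/(iso_mono (inv_counit_iso Y))/(ff_faithful ff). Qed.

Lemma inv_map1 Y : inv_map (idm Y) = idm (inv_obj Y).
Proof. by apply: inv_hom_eq; rewrite inv_counit_nat fmap1 compm1 comp1m. Qed.

Lemma inv_mapM X Y Z (g : Y ⟶ Z) (f : X ⟶ Y) :
  inv_map (g ∘ f) = inv_map g ∘ inv_map f.
Proof.
by apply: inv_hom_eq; rewrite fmapM compmA !inv_counit_nat -!compmA inv_counit_nat.
Qed.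

Definition inv_functor : functor D C := Functor inv_map1 inv_mapM.

Definition inv_unit (X : C) : X ⟶ inv_obj (F X) :=
  ff_lift ff (iso_inv (inv_counit_iso (F X))).

Lemma inv_unitK X : inv_counit (F X) ∘ fmap F (inv_unit X) = idm (F X).
Proof. by rewrite ff_liftK iso_invVK. Qed.

Lemma inv_unit_iso X : is_iso (inv_unit X).
Proof. by apply: (ff_reflects_iso ff); rewrite ff_liftK; apply: iso_inv_iso. Qed.

Lemma weak_equivalence_inv : is_equivalence F.
Proof.
exists inv_functor; split; last first.
  by exists inv_counit; split; [apply: inv_counit_iso | apply: inv_counit_nat].
exists inv_unit; split=> [|X Y f]; first exact: inv_unit_iso.
apply: inv_hom_eq; rewrite !fmapM compmA inv_unitK comp1m compmA.
by rewrite inv_counit_nat -compmA inv_unitK compm1.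
Qed.

Lemma inv_functor_weak : weak_equivalence inv_functor.
Proof.
split=> [Y Z h|X]; last first.
  exists (F X), (iso_inv (inv_unit_iso X)); exact: iso_inv_iso.
exists (inv_counit Z ∘ fmap F h ∘ iso_inv (inv_counit_iso Y)); split.
  apply: inv_hom_eq; rewrite inv_counit_nat -!compmA iso_invK.
  by rewrite compm1.
by move=> f <-; rewrite inv_counit_nat -compmA iso_invVK compm1.
Qed.

End Inverse.

Section ModuleFunctors.
Variable D : monoidal_category.
Implicit Types M N P : module_category D.

Section Composition.
Variables (M N P : module_category D) (G : module_functor N P) (F : module_functor M N).

Lemma comp_fmap1 (m : M) : fmap G (fmap F (idm m)) = idm (G (F m)).
Proof. by rewrite !fmap1. Qed.

Lemma comp_fmapM (m m' m'' : M) (g : m' ⟶ m'') (f : m ⟶ m') :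
  fmap G (fmap F (g ∘ f)) = fmap G (fmap F g) ∘ fmap G (fmap F f).
Proof. by rewrite !fmapM. Qed.

Definition comp_functor : functor M P := Functor comp_fmap1 comp_fmapM.

Definition comp_mod_act X (m : M) : comp_functor (X ⊙ m) ⟶ X ⊙ comp_functor m :=
  mod_act G X (F m) ∘ fmap G (mod_act F X m).

Lemma comp_mod_act_iso X (m : M) : is_iso (comp_mod_act X m).
Proof.
apply: is_iso_comp; first exact: mod_act_iso.
by apply: fmap_iso; apply: mod_act_iso.
Qed.

Lemma comp_mod_act_nat (X X' : D) (m m' : M) (f : X ⟶ X') (g : m ⟶ m') :
  comp_mod_act X' m' ∘ fmap comp_functor (f ⊙₁ g) =
  (f ⊙₁ fmap comp_functor g) ∘ comp_mod_act X m.
Proof.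
rewrite /comp_mod_act /= -compmA -fmapM mod_act_nat fmapM compmA.
by rewrite mod_act_nat -compmA.
Qed.

Lemma comp_mod_act_assoc (X Y : D) (m : M) :
  (idm X ⊙₁ comp_mod_act Y m) ∘ comp_mod_act X (Y ⊙ m)
      ∘ fmap comp_functor (act_assoc X Y m) =
    act_assoc X Y (comp_functor m) ∘ comp_mod_act (X ⊗ Y) m.
Proof.
rewrite /comp_mod_act /= -[idm X in LHS]comp1m actM.
rewrite -!compmA (compmA (_ ⊙₁ fmap G _)) -mod_act_nat -!compmA -!fmapM.
by rewrite (compmA _ (mod_act F X _)) mod_act_assoc !fmapM !compmA mod_act_assoc.
Qed.

Lemma comp_mod_act_unit (m : M) :
  act_unit (comp_functor m) ∘ comp_mod_act tunit m =
  fmap comp_functor (act_unit m).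
Proof. by rewrite /comp_mod_act /= compmA mod_act_unit -fmapM mod_act_unit. Qed.

Definition comp_module_functor : module_functor M P :=
  ModuleFunctor comp_mod_act_iso comp_mod_act_nat comp_mod_act_assoc
    comp_mod_act_unit.

Lemma comp_weak_equivalence :
  weak_equivalence G -> weak_equivalence F -> weak_equivalence comp_module_functor.
Proof.
move=> [ffG esG] [ffF esF]; split=> [X Y h|Y].
  exists (ff_lift ffF (ff_lift ffG h)); split=> [|f <-]; first by rewrite /= !ff_liftK.
  by apply: (ff_faithful ffF); apply: (ff_faithful ffG); rewrite !ff_liftK.
have [Z [g g_iso]] := esG Y; have [X [f f_iso]] := esF Z.
by exists X, (g ∘ fmap G f); apply: is_iso_comp => //; apply: fmap_iso.
Qed.

End Composition.

Lemma act1_iso M (X : D) (m m' : M) (f : m ⟶ m') :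
  is_iso f -> is_iso (idm X ⊙₁ f).
Proof.
by case=> g [gf fg]; exists (idm X ⊙₁ g); rewrite -!actM gf fg !comp1m !act1.
Qed.

(** * The quasi-inverse as a module functor *)

Section ModuleInverse.
Variables (M N : module_category D) (F : module_functor M N).
Hypotheses (ff : fully_faithful F) (es : essentially_surjective F).
Local Notation G := (inv_functor ff es).
Local Notation counit := (inv_counit es).

Lemma inv_mod_iso X (n : N) : is_iso ((idm X ⊙₁ counit n) ∘ mod_act F X (G n)).
Proof.
apply: is_iso_comp; last exact: mod_act_iso.
by apply: act1_iso; apply: inv_counit_iso.
Qed.

Definition inv_mod_act X (n : N) : G (X ⊙ n) ⟶ X ⊙ G n :=
  ff_lift ff (iso_inv (inv_mod_iso X n) ∘ counit (X ⊙ n)).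

(** The counit is a morphism of module functors. By [inv_mod_hom_eq] this equation determines
    [inv_mod_act], and the coherence laws follow from it. *)
Lemma inv_mod_actE X (n : N) :
  (idm X ⊙₁ counit n) ∘ (mod_act F X (G n) ∘ fmap F (inv_mod_act X n)) =
  counit (X ⊙ n).
Proof. by rewrite ff_liftK !compmA iso_invVK comp1m. Qed.

Lemma inv_mod_act_iso X (n : N) : is_iso (inv_mod_act X n).
Proof.
apply: (ff_reflects_iso ff); rewrite ff_liftK; apply: is_iso_comp.
  exact: iso_inv_iso.
exact: inv_counit_iso.
Qed.

Lemma inv_mod_hom_eq X (m : M) (n : N) (f g : m ⟶ X ⊙ G n) :
  (idm X ⊙₁ counit n) ∘ (mod_act F X (G n) ∘ fmap F f) =
  (idm X ⊙₁ counit n) ∘ (mod_act F X (G n) ∘ fmap F g) -> f = g.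
Proof. by rewrite !compmA => /(iso_mono (inv_mod_iso X n))/(ff_faithful ff). Qed.

Lemma inv_mod_act_nat (X X' : D) (n n' : N) (f : X ⟶ X') (g : n ⟶ n') :
  inv_mod_act X' n' ∘ fmap G (f ⊙₁ g) = (f ⊙₁ fmap G g) ∘ inv_mod_act X n.
Proof.
apply: inv_mod_hom_eq; rewrite !fmapM (compmA (mod_act _ _ _)).
rewrite (compmA (_ ⊙₁ counit n')) inv_mod_actE.
rewrite inv_counit_nat (compmA (mod_act _ _ _)) mod_act_nat -(compmA (f ⊙₁ _)).
rewrite (compmA (_ ⊙₁ counit n')) -actM.
by rewrite inv_counit_nat comp1m -[f in RHS]compm1 actM -compmA inv_mod_actE.
Qed.

Lemma inv_mod_act_assoc (X Y : D) (n : N) :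
  (idm X ⊙₁ inv_mod_act Y n) ∘ inv_mod_act X (Y ⊙ n) ∘ fmap G (act_assoc X Y n) =
  act_assoc X Y (G n) ∘ inv_mod_act (X ⊗ Y) n.
Proof.
(* Applying [F], then [mod_act] and [t], carries the target [X ⊙ (Y ⊙ G n)] to [X ⊙ (Y ⊙ n)], where
   both sides become the counit followed by the associator. *)
pose t := (idm X ⊙₁ (idm Y ⊙₁ counit n)) ∘ (idm X ⊙₁ mod_act F Y (G n)).
have t_mono : is_mono t.
  apply: iso_mono; apply: is_iso_comp; apply: act1_iso; last exact: mod_act_iso.
  by apply: act1_iso; apply: inv_counit_iso.
apply: (ff_faithful ff); apply: (iso_mono (mod_act_iso F X (Y ⊙ G n))).
apply: t_mono; rewrite /t !fmapM -!compmA.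
rewrite (compmA (mod_act F X _) (fmap F (idm X ⊙₁ _))) mod_act_nat -!compmA.
rewrite (compmA (idm X ⊙₁ mod_act _ _ _)) -actM.
rewrite (compmA (_ ⊙₁ (_ ⊙₁ _)) (_ ⊙₁ (_ ∘ _))) -actM !comp1m inv_mod_actE.
rewrite (compmA (mod_act F X _) (fmap F (inv_mod_act _ _))).
rewrite (compmA (_ ⊙₁ counit _)) inv_mod_actE.
rewrite inv_counit_nat; symmetry.
rewrite (compmA (mod_act F X _)) (compmA (idm X ⊙₁ mod_act _ _ _)) (compmA _ (mod_act F X _)).
rewrite mod_act_assoc -!compmA (compmA (_ ⊙₁ (_ ⊙₁ _))) -act_assoc_nat tensor1.
by rewrite -compmA inv_mod_actE.
Qed.

Lemma inv_mod_act_unit (n : N) :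
  act_unit (G n) ∘ inv_mod_act tunit n = fmap G (act_unit n).
Proof.
apply: (inv_hom_eq ff); rewrite inv_counit_nat fmapM -mod_act_unit !compmA.
by rewrite -act_unit_nat -!compmA inv_mod_actE.
Qed.

Definition inv_module_functor : module_functor N M :=
  ModuleFunctor inv_mod_act_iso inv_mod_act_nat inv_mod_act_assoc inv_mod_act_unit.

End ModuleInverse.

(** The two evaluations of enriched modules share their source, so one leg has to be inverted before
    composing. *)
Lemma module_equivalent_of_span K M N (F : module_functor K M) (G : module_functor K N) :
  weak_equivalence F -> weak_equivalence G -> module_equivalent M N.
Proof.
move=> [ffF esF] weG; exists (comp_module_functor G (inv_module_functor ffF esF)).
have [ff es] : weak_equivalence (comp_module_functor G (inv_module_functor ffF esF)).
  by apply: comp_weak_equivalence => //; apply: inv_functor_weak.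
exact: weak_equivalence_inv.
Qed.

End ModuleFunctors.

(** * Modules over an enriched category *)

(** The diagrammatic order fits right modules: with the first index fixed, composition is a right
    action. *)
Record enriched_category (D : monoidal_category) (I : Type) := EnrichedCategory {
  ehom :> I -> I -> D;
  emul : forall i j k, ehom i j ⊗ ehom j k ⟶ ehom i k;
  eunit : forall i, tunit ⟶ ehom i i;
  emulA : forall i j k l,
    emul i k l ∘ (emul i j k ⊗₁ idm (ehom k l)) =
    emul i j l ∘ (idm (ehom i j) ⊗₁ emul j k l)
      ∘ associator (ehom i j) (ehom j k) (ehom k l);
  emul1m : forall i j,
    emul i i j ∘ (eunit i ⊗₁ idm (ehom i j)) = lunitor (ehom i j);
  emulm1 : forall i j,
    emul i j j ∘ (idm (ehom i j) ⊗₁ eunit j) = runitor (ehom i j)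
}.
Arguments emul {D I} E i j k : rename.
Arguments eunit {D I} E i : rename.

Section EnrichedModules.
Variables (D : monoidal_category) (I : Type) (E : enriched_category D I).

Definition end_algebra (i : I) : algebra D :=
  Algebra (emulA E i i i i) (emul1m E i i) (emulm1 E i i).

Record emodule := EModule {
  emod_obj :> I -> D;
  emod_act : forall i j, emod_obj i ⊗ E i j ⟶ emod_obj j;
  emod_actA : forall i j k,
    emod_act j k ∘ (emod_act i j ⊗₁ idm (E j k)) =
    emod_act i k ∘ (idm (emod_obj i) ⊗₁ emul E i j k)
      ∘ associator (emod_obj i) (E i j) (E j k);
  emod_act1 : forall i,
    emod_act i i ∘ (idm (emod_obj i) ⊗₁ eunit E i) = runitor (emod_obj i)
}.
Arguments emod_act M i j : rename.
Implicit Types M N P : emodule.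

Record emod_hom M N := EmodHom {
  emod_map : forall i, M i ⟶ N i;
  emod_mapP : forall i j,
    emod_map j ∘ emod_act M i j = emod_act N i j ∘ (emod_map i ⊗₁ idm (E i j))
}.

Lemma emod_hom_eq M N (f g : emod_hom M N) :
  (forall i, emod_map f i = emod_map g i) -> f = g.
Proof.
case: f g => f fP [g gP] /= fg.
have e : f = g by exact: functional_extensionality_dep fg.
by case: _ / e {fg} gP => gP; congr EmodHom; apply: Prop_irrelevance.
Qed.

Lemma emod_idm_subproof M i j :
  idm (M j) ∘ emod_act M i j = emod_act M i j ∘ (idm (M i) ⊗₁ idm (E i j)).
Proof. by rewrite tensor1 comp1m compm1. Qed.

Definition emod_idm M : emod_hom M M := EmodHom (emod_idm_subproof M).

Lemma emod_comp_subproof M N P (g : emod_hom N P) (f : emod_hom M N) i j :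
  emod_map g j ∘ emod_map f j ∘ emod_act M i j =
  emod_act P i j ∘ ((emod_map g i ∘ emod_map f i) ⊗₁ idm (E i j)).
Proof. by rewrite -compmA emod_mapP compmA emod_mapP -compmA tensorM1. Qed.

Definition emod_comp M N P (g : emod_hom N P) (f : emod_hom M N) : emod_hom M P :=
  EmodHom (emod_comp_subproof g f).

Lemma emod_comp1m M N (f : emod_hom M N) : emod_comp (emod_idm N) f = f.
Proof. by apply: emod_hom_eq => i; apply: comp1m. Qed.

Lemma emod_compm1 M N (f : emod_hom M N) : emod_comp f (emod_idm M) = f.
Proof. by apply: emod_hom_eq => i; apply: compm1. Qed.

Lemma emod_compmA M N P Q (h : emod_hom P Q) (g : emod_hom N P) (f : emod_hom M N) :
  emod_comp h (emod_comp g f) = emod_comp (emod_comp h g) f.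
Proof. by apply: emod_hom_eq => i; apply: compmA. Qed.

Definition emod_cat : category := Category emod_comp1m emod_compm1 emod_compmA.

Section LeftTensor.
Variables (X : D) (M : emodule).

Definition etensor_act i j : X ⊗ M i ⊗ E i j ⟶ X ⊗ M j :=
  (idm X ⊗₁ emod_act M i j) ∘ associator X (M i) (E i j).

Lemma etensor_actA i j k :
  etensor_act j k ∘ (etensor_act i j ⊗₁ idm (E j k)) =
  etensor_act i k ∘ (idm (X ⊗ M i) ⊗₁ emul E i j k)
    ∘ associator (X ⊗ M i) (E i j) (E j k).
Proof.
rewrite /etensor_act tensorM1 -!compmA (compmA (associator X _ _)).
rewrite associator_nat !compmA -tensor1M emod_actA !tensor1M -!compmA.
rewrite (compmA (idm X ⊗₁ associator _ _ _)) pentagon -tensor1.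
by rewrite (reassoc _ (associator_nat _ _ _)) -!compmA.
Qed.

Lemma etensor_act1 i :
  etensor_act i i ∘ (idm (X ⊗ M i) ⊗₁ eunit E i) = runitor (X ⊗ M i).
Proof.
rewrite /etensor_act -compmA -tensor1 associator_nat compmA -tensor1M.
by rewrite emod_act1 runitor_tensor.
Qed.

Definition etensor : emodule := EModule etensor_actA etensor_act1.

End LeftTensor.

Lemma etensor_hom_subproof (X X' : D) M M' (f : X ⟶ X') (g : emod_hom M M') i j :
  (f ⊗₁ emod_map g j) ∘ emod_act (etensor X M) i j =
  emod_act (etensor X' M') i j ∘ ((f ⊗₁ emod_map g i) ⊗₁ idm (E i j)).
Proof.
rewrite /= /etensor_act -compmA associator_nat !compmA -!tensorM.
by rewrite compm1 comp1m emod_mapP.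
Qed.

Definition etensor_hom (X X' : D) M M' (f : X ⟶ X') (g : emod_hom M M') :
  emod_hom (etensor X M) (etensor X' M') :=
  @EmodHom (etensor X M) (etensor X' M') _ (etensor_hom_subproof f g).

Lemma etensor_assoc_subproof (X Y : D) M i j :
  associator X Y (M j) ∘ emod_act (etensor (X ⊗ Y) M) i j =
  emod_act (etensor X (etensor Y M)) i j ∘ (associator X Y (M i) ⊗₁ idm (E i j)).
Proof.
rewrite /= /etensor_act compmA -tensor1 associator_nat -compmA -pentagon.
by rewrite /= /etensor_act tensor1M !compmA.
Qed.

Definition etensor_assoc (X Y : D) M :
  emod_hom (etensor (X ⊗ Y) M) (etensor X (etensor Y M)) :=
  @EmodHom (etensor (X ⊗ Y) M) (etensor X (etensor Y M)) _
    (etensor_assoc_subproof X Y M).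

Lemma etensor_unit_subproof M i j :
  lunitor (M j) ∘ emod_act (etensor tunit M) i j =
  emod_act M i j ∘ (lunitor (M i) ⊗₁ idm (E i j)).
Proof.
by rewrite /= /etensor_act compmA lunitor_nat -compmA lunitor_tensor.
Qed.

Definition etensor_unit M : emod_hom (etensor tunit M) M :=
  @EmodHom (etensor tunit M) M _ (etensor_unit_subproof M).

Lemma emod_iso (M N : emod_cat) (f : M ⟶ N) :
  (forall i, is_iso (emod_map f i)) -> is_iso f.
Proof.
move=> f_iso.
have gP i j : iso_inv (f_iso j) ∘ emod_act N i j =
    emod_act M i j ∘ (iso_inv (f_iso i) ⊗₁ idm (E i j)).
  apply: (iso_mono (f_iso j)); rewrite !compmA iso_invVK comp1m emod_mapP.
  by rewrite -compmA -tensorM1 iso_invVK tensor1 compm1.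
exists (EmodHom gP); split; apply: emod_hom_eq => i.
  exact: iso_invK.
exact: iso_invVK.
Qed.

Lemma etensor_assoc_iso (X Y : D) M :
  is_iso (etensor_assoc X Y M : hom (c := emod_cat) _ _).
Proof.
apply: emod_iso => i; exists (associator_inv X Y (M i)).
by split; [apply: associatorK | apply: associatorVK].
Qed.

Lemma etensor_unit_iso M : is_iso (etensor_unit M : hom (c := emod_cat) _ _).
Proof.
apply: emod_iso => i; exists (lunitor_inv (M i)).
by split; [apply: lunitorK | apply: lunitorVK].
Qed.

Lemma etensor1 (X : D) M : etensor_hom (idm X) (emod_idm M) = emod_idm (etensor X M).
Proof. by apply: emod_hom_eq => i; apply: tensor1. Qed.

Lemma etensorM (X X' X'' : D) M M' M'' (f' : X' ⟶ X'') (f : X ⟶ X')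
    (g' : emod_hom M' M'') (g : emod_hom M M') :
  etensor_hom (f' ∘ f) (emod_comp g' g) =
  emod_comp (etensor_hom f' g') (etensor_hom f g).
Proof. by apply: emod_hom_eq => i; apply: tensorM. Qed.

Lemma etensor_assoc_nat (X X' Y Y' : D) M M' (f : X ⟶ X') (g : Y ⟶ Y')
    (h : emod_hom M M') :
  emod_comp (etensor_assoc X' Y' M') (etensor_hom (f ⊗₁ g) h) =
  emod_comp (etensor_hom f (etensor_hom g h)) (etensor_assoc X Y M).
Proof. by apply: emod_hom_eq => i; apply: associator_nat. Qed.

Lemma etensor_unit_nat M M' (h : emod_hom M M') :
  emod_comp (etensor_unit M') (etensor_hom (idm tunit) h) =
  emod_comp h (etensor_unit M).
Proof. by apply: emod_hom_eq => i; apply: lunitor_nat. Qed.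

Lemma etensor_pentagon (X Y Z : D) M :
  emod_comp
    (emod_comp (etensor_hom (idm X) (etensor_assoc Y Z M))
       (etensor_assoc X (Y ⊗ Z) M))
    (etensor_hom (associator X Y Z) (emod_idm M)) =
  emod_comp (etensor_assoc X Y (etensor Z M)) (etensor_assoc (X ⊗ Y) Z M).
Proof. by apply: emod_hom_eq => i; apply: pentagon. Qed.

Lemma etensor_triangle (X : D) M :
  emod_comp (etensor_hom (idm X) (etensor_unit M)) (etensor_assoc X tunit M) =
  etensor_hom (runitor X) (emod_idm M).
Proof. by apply: emod_hom_eq => i; apply: triangle. Qed.

Definition emod_modcat : module_category D :=
  @ModuleCategory D emod_cat etensor etensor_hom etensor_assoc etensor_unit
    etensor1 etensorM etensor_assoc_nat etensor_unit_nat etensor_assoc_iso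
    etensor_unit_iso etensor_pentagon etensor_triangle.

Section Evaluation.
Variable i : I.

Definition eval_obj M : right_module (end_algebra i) :=
  @RightModule D (end_algebra i) (M i) (emod_act M i i) (emod_actA M i i i)
    (emod_act1 M i).

Definition eval_map M N (f : emod_hom M N) : rmod_hom (eval_obj M) (eval_obj N) :=
  @RmodHom D (end_algebra i) (eval_obj M) (eval_obj N) (emod_map f i)
    (emod_mapP f i i).

Lemma eval_map1 M : eval_map (emod_idm M) = rmod_idm (eval_obj M).
Proof. exact: rmod_hom_eq. Qed.

Lemma eval_mapM M N P (g : emod_hom N P) (f : emod_hom M N) :
  eval_map (emod_comp g f) = rmod_comp (eval_map g) (eval_map f).
Proof. exact: rmod_hom_eq. Qed.

Definition eval_functor : functor emod_modcat (rmod_modcat (end_algebra i)) :=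
  @Functor emod_modcat (rmod_modcat (end_algebra i)) eval_obj eval_map
    eval_map1 eval_mapM.

Definition eval_act X M :
  rmod_hom (eval_obj (etensor X M)) (rtensor X (eval_obj M)) :=
  @RmodHom D (end_algebra i) (eval_obj (etensor X M)) (rtensor X (eval_obj M))
    (idm (X ⊗ M i)) (emod_idm_subproof (etensor X M) i i).

Lemma eval_act_iso X M :
  is_iso (eval_act X M : hom (c := rmod_cat (end_algebra i)) _ _).
Proof. by apply: rmod_iso; apply: is_iso_id. Qed.

Lemma eval_act_nat (X X' : D) M M' (f : X ⟶ X') (g : emod_hom M M') :
  rmod_comp (eval_act X' M') (eval_map (etensor_hom f g)) =
  rmod_comp (rtensor_hom f (eval_map g)) (eval_act X M).
Proof. by apply: rmod_hom_eq; rewrite /= comp1m compm1. Qed.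

Lemma eval_act_assoc (X Y : D) M :
  rmod_comp (rmod_comp (rtensor_hom (idm X) (eval_act Y M)) (eval_act X (etensor Y M)))
    (eval_map (etensor_assoc X Y M)) =
  rmod_comp (rtensor_assoc X Y (eval_obj M)) (eval_act (X ⊗ Y) M).
Proof. by apply: rmod_hom_eq; rewrite /= tensor1 !comp1m compm1. Qed.

Lemma eval_act_unit M :
  rmod_comp (rtensor_unit (eval_obj M)) (eval_act tunit M) =
  eval_map (etensor_unit M).
Proof. by apply: rmod_hom_eq; rewrite /= compm1. Qed.

Definition eval_module_functor :
  module_functor emod_modcat (rmod_modcat (end_algebra i)) :=
  @ModuleFunctor D emod_modcat (rmod_modcat (end_algebra i)) eval_functor eval_act
    eval_act_iso eval_act_nat eval_act_assoc eval_act_unit.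

End Evaluation.
End EnrichedModules.

(** * Evaluation of modules at an object *)

Definition idempotent_complete (C : category) : Prop :=
  forall (X : C) (e : X ⟶ X), e ∘ e = e ->
    exists Y (p : X ⟶ Y) (s : Y ⟶ X), p ∘ s = idm Y /\ s ∘ p = e.

Lemma runitor_inv_nat (D : monoidal_category) (X Y : D) (f : X ⟶ Y) :
  runitor_inv Y ∘ f = (f ⊗₁ idm tunit) ∘ runitor_inv X.
Proof.
apply: (split_mono (runitorK Y)); rewrite !compmA runitorVK comp1m runitor_nat.
by rewrite -compmA runitorVK compm1.
Qed.

Lemma associator_inv_nat (D : monoidal_category) (X X' Y Y' Z Z' : D)
    (f : X ⟶ X') (g : Y ⟶ Y') (h : Z ⟶ Z') :
  associator_inv X' Y' Z' ∘ (f ⊗₁ (g ⊗₁ h)) =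
  ((f ⊗₁ g) ⊗₁ h) ∘ associator_inv X Y Z.
Proof.
apply: (associator_mono); rewrite !compmA associatorVK comp1m associator_nat.
by rewrite -compmA associatorVK compm1.
Qed.

Section Representable.
Variables (D : monoidal_category) (I : Type) (E : enriched_category D I).

(** The representable module at [i]; tensored with [X], it is the free module on [X] placed at
    [i]. *)
Definition erep (i : I) : emodule E := EModule (emulA E i) (emulm1 E i).

(** The counit of the free construction. As a module map, it lets naturality in the module be
    applied to the action itself. *)
Definition eaction (M : emodule E) (i : I) :
    emod_hom (etensor (M i) (erep i)) M :=
  @EmodHom D I E (etensor (M i) (erep i)) M (emod_act M i)
    (fun j k => etrans (compmA _ _ _) (esym (emod_actA M i j k))).
End Representable.

Section Evaluation.
Variables (D : monoidal_category) (I : Type) (E : enriched_category D I) (i : I).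
Variable c : forall k, tunit ⟶ E k i ⊗ E i k.
Hypothesis cK : forall k, emul E k i k ∘ c k = eunit E k.
Implicit Types M N : emodule E.

(* [x ↦ x c' ⊗ c''] where [c k = c' ⊗ c'']; locked because rewriting with [compmA]
   would otherwise unfold it. *)
Definition esection M k : M k ⟶ M i ⊗ E i k :=
  locked ((emod_act M k i ⊗₁ idm (E i k)) ∘ associator_inv (M k) (E k i) (E i k)
    ∘ (idm (M k) ⊗₁ c k) ∘ runitor_inv (M k)).

(** In elements, [(x c') c'' = x (c' c'') = x 1 = x]. *)
Lemma esectionK M k : emod_act M i k ∘ esection M k = idm (M k).
Proof.
rewrite /esection -!lock !compmA emod_actA -(compmA _ (associator _ _ _)) associatorVK.
by rewrite compm1 -(compmA (emod_act _ _ _)) -tensor1M cK emod_act1 runitorVK.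
Qed.

Lemma esection_nat M N (f : emod_hom M N) k :
  esection N k ∘ emod_map f k = (emod_map f i ⊗₁ idm (E i k)) ∘ esection M k.
Proof.
rewrite /esection -!lock -!compmA runitor_inv_nat (compmA (idm _ ⊗₁ c k)) tensor_1l.
rewrite !compmA; congr (_ ∘ _ ∘ _); rewrite -tensor1 -!compmA associator_inv_nat.
by rewrite !compmA -!tensorM1 emod_mapP.
Qed.

Section FullyFaithful.
Variables (M N : emodule E) (f : rmod_hom (eval_obj i M) (eval_obj i N)).

(** In elements, [x ↦ f(x c') c'']; the formula is forced, since [x = (x c') c'']. *)
Definition eextend k : M k ⟶ N k :=
  emod_act N i k ∘ (rmod_map f ⊗₁ idm (E i k)) ∘ esection M k.

(** Naturality along [eaction] computes the section of [x e] in the free module. Then [f] meets only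
    products formed in [M i], where its linearity applies. *)
Lemma eextend_act k :
  eextend k ∘ emod_act M i k = emod_act N i k ∘ (rmod_map f ⊗₁ idm (E i k)).
Proof.
rewrite /eextend -compmA (esection_nat (eaction M i)).
(* From here on [w] is used only as a section of the composition, not through its formula. *)
move: (esection _ _) (esectionK (etensor (M i) (erep E i)) k) => /= w.
rewrite /etensor_act /= => wK.
rewrite compmA -(compmA (emod_act N i k)) -tensorM1.
rewrite (rmod_mapP f) /= tensorM1 !compmA emod_actA -!compmA.
congr (_ ∘ _); rewrite (reassoc _ (associator_nat _ _ _)) -!compmA tensor1.
rewrite compmA -tensorM compm1 comp1m -{1}[rmod_map f]compm1.
by rewrite -[emul _ _ _ _]comp1m tensorM -compmA (compmA (_ ⊗₁ emul _ _ _ _)) wK compm1.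
Qed.

Lemma emod_act_epi k : is_epi (emod_act M i k).
Proof. exact: split_epi (esectionK M k). Qed.

Lemma emod_act1_epi k (X : D) : is_epi (emod_act M i k ⊗₁ idm X).
Proof.
apply: (split_epi (s := esection M k ⊗₁ idm X)).
by rewrite -tensorM1 esectionK tensor1.
Qed.

(** The products [x e] with [x] in [M i] cover [M j], also after tensoring, so both sides need
    comparing only on [x e ⊗ e'], where associativity and [eextend_act] decide. *)
Lemma eextendP j k :
  eextend k ∘ emod_act M j k = emod_act N j k ∘ (eextend j ⊗₁ idm (E j k)).
Proof.
apply: emod_act1_epi; rewrite -compmA emod_actA !compmA eextend_act.
rewrite -[X in _ = X]compmA -tensorM1 eextend_act tensorM1 compmA emod_actA.
rewrite -!compmA; congr (_ ∘ _); rewrite !compmA -tensorM compm1 comp1m.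
rewrite -[in RHS]compmA associator_nat compmA -tensorM tensor1 compm1.
by rewrite comp1m.
Qed.

End FullyFaithful.

Lemma eval_fully_faithful : fully_faithful (eval_functor E i).
Proof.
move=> M N f; exists (EmodHom (eextendP f)); split=> [|g fE].
  apply: rmod_hom_eq; apply: (@emod_act_epi M i); rewrite eextend_act.
  by rewrite -(rmod_mapP f).
apply: emod_hom_eq => k; apply: (@emod_act_epi M k).
by rewrite [LHS]eextend_act -fE -emod_mapP.
Qed.

(** * Extension of modules from [E i i] to [E] *)

Section Extension.
Variable D_split : idempotent_complete D.
Variable N : right_module (end_algebra E i).

(* The coequalizer of [u, v : R' ⟶ R] is the extension [N ⊗_(E i i) E i -]; the
   pair is split by [w], so the coequalizer is the splitting of an idempotent. *)
Local Notation R := (etensor (N : D) (erep E i)).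
Local Notation R' := (etensor ((N : D) ⊗ E i i) (erep E i)).
Definition ext_u : emod_hom R' R := etensor_hom (rmod_act N) (emod_idm (erep E i)).
Definition ext_v : emod_hom R' R := eaction R i.
Local Notation ext_w k := (esection R k).

Lemma ext_vw k : emod_map ext_v k ∘ ext_w k = idm (R k).
Proof. exact: esectionK. Qed.

(** Naturality moves [u] and [v] past the section, to their components at [i]. The outer [u] then
    applies the action of [N], which identifies these by associativity. With [ext_vw] this makes
    [u w] idempotent. *)
Lemma ext_uwu k :
  emod_map ext_u k ∘ ext_w k ∘ emod_map ext_u k =
  emod_map ext_u k ∘ ext_w k ∘ emod_map ext_v k.
Proof.
rewrite -!compmA (esection_nat ext_u) (esection_nat ext_v) !compmA.
congr (_ ∘ _); rewrite /= -!tensorM1 /etensor_act compmA.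
by congr (_ ⊗₁ _); exact: rmod_actA.
Qed.

Lemma ext_split k : exists (Y : D) (p : R k ⟶ Y) (s : Y ⟶ R k),
  p ∘ s = idm Y /\ s ∘ p = emod_map ext_u k ∘ ext_w k.
Proof.
by apply: D_split; rewrite compmA ext_uwu -compmA ext_vw compm1.
Qed.

Definition ext_obj k : D := sval (cid (ext_split k)).
Definition ext_proj k : R k ⟶ ext_obj k := sval (cid (svalP (cid (ext_split k)))).
Definition ext_incl k : ext_obj k ⟶ R k :=
  sval (cid (svalP (cid (svalP (cid (ext_split k)))))).

Lemma ext_projK k : ext_proj k ∘ ext_incl k = idm (ext_obj k).
Proof. by case: (svalP (cid (svalP (cid (svalP (cid (ext_split k))))))). Qed.

Lemma ext_inclK k : ext_incl k ∘ ext_proj k = emod_map ext_u k ∘ ext_w k.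
Proof. by case: (svalP (cid (svalP (cid (svalP (cid (ext_split k))))))). Qed.

Lemma ext_proj_uv k : ext_proj k ∘ emod_map ext_u k = ext_proj k ∘ emod_map ext_v k.
Proof.
rewrite -[X in X ∘ _ = _]comp1m -[X in _ = X ∘ _]comp1m -ext_projK.
by rewrite -!(compmA _ (ext_incl k)) ext_inclK -!compmA !(compmA (emod_map ext_u k)) ext_uwu.
Qed.

(** As [ext_incl ∘ ext_proj] is [u w], a balanced [h] satisfies [h u w = h v w = h]. The coequalizer
    is split, hence preserved by tensoring with [Y]. *)
Lemma ext_balanced k Y Z (h : R k ⊗ Y ⟶ Z) :
  h ∘ (emod_map ext_u k ⊗₁ idm Y) = h ∘ (emod_map ext_v k ⊗₁ idm Y) ->
  h ∘ ((ext_incl k ∘ ext_proj k) ⊗₁ idm Y) = h.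
Proof.
move=> e; rewrite ext_inclK tensorM1 compmA e -compmA -tensorM1 ext_vw.
by rewrite tensor1 compm1.
Qed.

Definition ext_act j k : ext_obj j ⊗ E j k ⟶ ext_obj k :=
  locked (ext_proj k ∘ emod_act R j k ∘ (ext_incl j ⊗₁ idm (E j k))).

(** The quotient action is computed on a representative. Since [u] and [v] are module maps, acting
    and then projecting is balanced, so the representative does not matter. *)
Lemma ext_projP j k :
  ext_proj k ∘ emod_act R j k = ext_act j k ∘ (ext_proj j ⊗₁ idm (E j k)).
Proof.
rewrite /ext_act -lock -[RHS]compmA -tensorM1 ext_balanced //.
rewrite -!(compmA (ext_proj k)) -!emod_mapP.
by rewrite !(compmA _ (emod_map _ _)) ext_proj_uv.
Qed.

Lemma ext_proj1_epi k X : is_epi (ext_proj k ⊗₁ idm X).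
Proof.
apply: (split_epi (s := ext_incl k ⊗₁ idm X)).
by rewrite -tensorM1 ext_projK tensor1.
Qed.

Lemma ext_actA i0 j k :
  ext_act j k ∘ (ext_act i0 j ⊗₁ idm (E j k)) =
  ext_act i0 k ∘ (idm (ext_obj i0) ⊗₁ emul E i0 j k)
    ∘ associator (ext_obj i0) (E i0 j) (E j k).
Proof.
have epi2 : is_epi ((ext_proj i0 ⊗₁ idm (E i0 j)) ⊗₁ idm (E j k)).
  apply: (split_epi (s := (ext_incl i0 ⊗₁ idm (E i0 j)) ⊗₁ idm (E j k))).
  by rewrite -!tensorM1 ext_projK !tensor1.
apply: epi2; rewrite -compmA -tensorM1 -ext_projP tensorM1 (compmA (ext_act j k)) -ext_projP.
rewrite -(compmA (ext_proj k)) emod_actA (compmA (ext_proj k) _ (associator _ _ _)).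
rewrite (compmA (ext_proj k) (emod_act _ _ _)) ext_projP -!compmA; congr (_ ∘ _).
by rewrite associator_nat !compmA tensor1 tensor_1l.
Qed.

Lemma ext_act1 j :
  ext_act j j ∘ (idm (ext_obj j) ⊗₁ eunit E j) = runitor (ext_obj j).
Proof.
apply: (@ext_proj1_epi j); rewrite runitor_nat -compmA tensor_1l compmA -ext_projP.
by rewrite -compmA emod_act1.
Qed.

Definition extension : emodule E := EModule ext_actA ext_act1.

Definition ext_iso_map : extension i ⟶ (N : D) :=
  locked (rmod_act N ∘ ext_incl i).

Lemma rmod_act_uv : rmod_act N ∘ emod_map ext_u i = rmod_act N ∘ emod_map ext_v i.
Proof. by rewrite /= /etensor_act compmA; exact: rmod_actA. Qed.

Lemma ext_iso_proj : ext_iso_map ∘ ext_proj i = rmod_act N.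
Proof.
by rewrite /ext_iso_map -lock -compmA ext_inclK compmA rmod_act_uv -compmA ext_vw compm1.
Qed.

Lemma ext_iso_mapP :
  ext_iso_map ∘ rmod_act (eval_obj i extension) =
  rmod_act N ∘ (ext_iso_map ⊗₁ idm (E i i)).
Proof.
apply: (@ext_proj1_epi i); rewrite -!compmA /= -ext_projP -tensorM1 compmA.
rewrite ext_iso_proj; symmetry; rewrite [LHS]rmod_actA /= /etensor_act.
by rewrite compmA.
Qed.

Lemma ext_iso : is_iso ext_iso_map.
Proof.
(* The inverse sends [x] to the class of [x ⊗ 1]. *)
exists (ext_proj i ∘ (idm (N : D) ⊗₁ eunit E i) ∘ runitor_inv N).
split; last first.
  rewrite !compmA ext_iso_proj.
  by have := rmod_act1 N => /= ->; rewrite runitorVK.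
apply: (split_epi (ext_projK i)); rewrite -(compmA _ ext_iso_map) ext_iso_proj comp1m.
rewrite -(compmA _ (runitor_inv _)) runitor_inv_nat compmA.
rewrite -(compmA (ext_proj i)) tensor_1l (compmA (ext_proj i)).
(* In the quotient, [x a ⊗ 1] equals [x ⊗ a 1]. *)
rewrite [ext_proj i ∘ _](ext_proj_uv i) -(compmA (ext_proj i)).
have -> : emod_map ext_v i ∘ (idm (R i) ⊗₁ eunit E i) = runitor (R i).
  exact: (emod_act1 R i).
by rewrite -compmA runitorVK compm1.
Qed.

End Extension.

Lemma eval_weak_equivalence :
  idempotent_complete D -> weak_equivalence (eval_functor E i).
Proof.
move=> D_split; split=> [|N]; first exact: eval_fully_faithful.
exists (extension D_split N), (RmodHom (ext_iso_mapP D_split N)).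
by apply: rmod_iso; apply: ext_iso.
Qed.

End Evaluation.

Lemma enriched_morita (D : monoidal_category) (I : Type) (E : enriched_category D I)
    (i j : I) :
  idempotent_complete D ->
  (forall k l, exists c : tunit ⟶ E k l ⊗ E l k, emul E k l k ∘ c = eunit E k) ->
  morita_equivalent (end_algebra E i) (end_algebra E j).
Proof.
move=> D_split c_ex.
apply: (@module_equivalent_of_span _ (emod_modcat E) _ _ (eval_module_functor E i)
  (eval_module_functor E j)).
  by apply: (eval_weak_equivalence (fun k => svalP (cid (c_ex k i)))).
by apply: (eval_weak_equivalence (fun k => svalP (cid (c_ex k j)))).
Qed.

(** * Semisimple abelian categories *)

Section LinearMaps.
Local Open Scope ring_scope.
Local Open Scope cat_scope.
Variables (k : fieldType) (U V : lmodType k) (h : U -> V).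
Hypothesis h_lin : linear h.

Lemma linear_add u v : h (u + v) = h u + h v.
Proof. by have := h_lin 1 u v; rewrite !scale1r. Qed.

Lemma linear_zero : h 0 = 0.
Proof. by apply: (addrI (h 0)); rewrite -linear_add !addr0. Qed.

Lemma linear_sub u v : h (u - v) = h u - h v.
Proof. by have := h_lin (-1) v u; rewrite !scaleN1r !(addrC (- _)). Qed.
End LinearMaps.

Section LinearCategories.
Local Open Scope ring_scope.
Local Open Scope cat_scope.
Variables (k : fieldType) (C : category) (L : hom_lmodule k C).
Hypothesis L_lin : is_linear_category L.
Implicit Types X Y Z V W : C.
Local Notation "X ⟶ₖ Y" := (lhom L X Y) : cat_scope.

Lemma comp0m X Y Z (f : X ⟶ₖ Y) : (0 : Y ⟶ₖ Z) ∘ f = 0 :> (X ⟶ₖ Z).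
Proof. exact: linear_zero (L_lin.1 X Y Z f). Qed.

Lemma compm0 X Y Z (g : Y ⟶ₖ Z) : g ∘ (0 : X ⟶ₖ Y) = 0 :> (X ⟶ₖ Z).
Proof. exact: linear_zero (L_lin.2 X Y Z g). Qed.

Lemma compmD X Y Z (g : Y ⟶ₖ Z) (f h : X ⟶ₖ Y) :
  g ∘ (f + h) = (g ∘ f : X ⟶ₖ Z) + (g ∘ h : X ⟶ₖ Z) :> (X ⟶ₖ Z).
Proof. exact: linear_add (L_lin.2 X Y Z g) f h. Qed.

Lemma compBm X Y Z (g h : Y ⟶ₖ Z) (f : X ⟶ₖ Y) :
  (g - h) ∘ f = (g ∘ f : X ⟶ₖ Z) - (h ∘ f : X ⟶ₖ Z) :> (X ⟶ₖ Z).
Proof. exact: linear_sub (L_lin.1 X Y Z f) g h. Qed.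

Lemma compmB X Y Z (g : Y ⟶ₖ Z) (f h : X ⟶ₖ Y) :
  g ∘ (f - h) = (g ∘ f : X ⟶ₖ Z) - (g ∘ h : X ⟶ₖ Z) :> (X ⟶ₖ Z).
Proof. exact: linear_sub (L_lin.2 X Y Z g) f h. Qed.

Lemma compm_sum X Y Z (g : Y ⟶ₖ Z) n (f : 'I_n -> (X ⟶ₖ Y)) :
  g ∘ (\sum_(a < n) f a) = \sum_(a < n) (g ∘ f a : X ⟶ₖ Z) :> (X ⟶ₖ Z).
Proof. exact: (big_morph (fun f : X ⟶ₖ Y => (g ∘ f : X ⟶ₖ Z)) (compmD g) (compm0 X g)). Qed.

Lemma cokernel_epi X Y Q (f : X ⟶ₖ Y) (p : Y ⟶ₖ Q) : is_cokernel f p -> is_epi p.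
Proof.
case=> pf p_univ Z g h e.
have [|u [_ u_uniq]] := p_univ Z (h ∘ p).
  by rewrite -compmA pf compm0.
by rewrite -(u_uniq g) // -(u_uniq h).
Qed.

Lemma kernel_mono X Y K (f : X ⟶ₖ Y) (i : K ⟶ₖ X) : is_kernel f i -> is_mono i.
Proof.
case=> fi i_univ Z g h e.
have [|u [_ u_uniq]] := i_univ Z (i ∘ h).
  by rewrite compmA fi comp0m.
by rewrite -(u_uniq g) // -(u_uniq h).
Qed.

Lemma idm_zero_obj X : idm X = 0 :> (X ⟶ₖ X) -> is_zero_obj X.
Proof.
move=> X0 Y; split; exists (0 : _ ⟶ₖ _); split=> // f _.
  by rewrite -[RHS]comp1m X0 comp0m.
by rewrite -[RHS]compm1 X0 compm0.
Qed.

Lemma from_zero_obj Z X (f : Z ⟶ₖ X) : is_zero_obj Z -> f = 0.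
Proof.
move=> /(_ X) [_ [g [_ g_uniq]]].
by rewrite -(g_uniq f) // -(g_uniq (0 : Z ⟶ₖ X)).
Qed.

Lemma kernel_zero_mono X Y K (f : X ⟶ₖ Y) (i : K ⟶ₖ X) :
  is_kernel f i -> i = 0 -> is_mono f.
Proof.
move=> [_ i_univ] i0 Z g h e; apply: (@subr0_eq (lhom L Z X)).
have [|u [<- _]] := i_univ Z ((g : Z ⟶ₖ X) - (h : Z ⟶ₖ X)).
  by rewrite compmB e subrr.
by rewrite i0 comp0m.
Qed.

Lemma cokernel_zero_epi X Y Q (f : X ⟶ₖ Y) (p : Y ⟶ₖ Q) :
  is_cokernel f p -> p = 0 -> is_epi f.
Proof.
move=> [_ p_univ] p0 Z g h e; apply: (@subr0_eq (lhom L Y Z)).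
have [|u [<- _]] := p_univ Z ((g : Y ⟶ₖ Z) - (h : Y ⟶ₖ Z)).
  by rewrite compBm e subrr.
by rewrite p0 compm0.
Qed.

Hypothesis L_abelian : is_abelian L.

Lemma has_kernel X Y (f : X ⟶ₖ Y) : exists K (i : K ⟶ₖ X), is_kernel f i.
Proof. by case: L_abelian => _ _ /(_ X Y f) []. Qed.

Lemma has_cokernel X Y (f : X ⟶ₖ Y) : exists Q (p : Y ⟶ₖ Q), is_cokernel f p.
Proof. by case: L_abelian => _ _ /(_ X Y f) []. Qed.

(** Either the kernel of [f] is all of [V], and [f] vanishes, or [f] is a monomorphism from a
    nonzero object into a simple one. *)
Lemma schur V W (f : V ⟶ₖ W) : is_simple L V -> is_simple L W -> f <> 0 -> is_iso f.
Proof.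
move=> [V_nz V_simple] [_ W_simple] f_nz.
have [K [i i_ker]] := has_kernel f.
have [K0|i_iso] := V_simple _ i (kernel_mono i_ker).
  have i0 : i = 0 := from_zero_obj i K0.
  by have [|] := W_simple _ f (kernel_zero_mono i_ker i0).
case: f_nz; apply: (iso_epi i_iso).
by rewrite i_ker.1 comp0m.
Qed.

(** The image of an idempotent [e] is the cokernel of [1 - e]. *)
Lemma abelian_idempotent_complete : idempotent_complete C.
Proof.
move=> X e ee; have [Q [p p_coker]] := has_cokernel ((idm X : X ⟶ₖ X) - (e : X ⟶ₖ X)).
have [pe0 p_univ] := p_coker.
have [|s [sp _]] := p_univ X e; first by rewrite compmB compm1 ee subrr.
exists Q, p, s; split=> //; apply: (cokernel_epi p_coker).
move: pe0; rewrite compmB compm1 => /subr0_eq pe.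
by rewrite comp1m -compmA sp -pe.
Qed.

Hypotheses (L_semisimple : is_semisimple L) (L_finite : is_finite_category L).

(** Some simple summand of a projective object covering [V] maps to [V] nontrivially, hence
    isomorphically by [schur]; so [V] is a retract of a projective. *)
Lemma simple_projective (V : C) : is_simple L V -> is_projective V.
Proof.
move=> V_simple; have [_ _ enough _] := L_finite.
have [P [e [P_proj e_epi]]] := enough V.
have [n [W [W_simple [i [p [_ _ ip]]]]]] := L_semisimple P.
have [a ei_nz] : exists a, e ∘ i a <> 0 :> (W a ⟶ₖ V).
  apply: contrapT => ei0; apply: V_simple.1; apply: idm_zero_obj.
  apply: e_epi; rewrite comp1m comp0m -[LHS]compm1 -ip compm_sum.
  rewrite big1 // => a _; rewrite compmA.
  suff -> : e ∘ i a = 0 :> (W a ⟶ₖ V) by rewrite comp0m.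
  by apply: contrapT => ei; apply: ei0; exists a.
have [r [_ er]] := schur (W_simple a) V_simple ei_nz.
move=> X Y q f q_epi; have [g qg] := P_proj X Y q (f ∘ e) q_epi.
exists (g ∘ (i a ∘ r)).
by rewrite compmA qg -compmA !compmA -(compmA f) -(compmA f) er compm1.
Qed.

Lemma semisimple_projective (P : C) : is_projective P.
Proof.
have [n [W [W_simple [i [p [_ _ ip]]]]]] := L_semisimple P.
move=> X Y q f q_epi.
have g a := cid (simple_projective (W_simple a) (f ∘ i a) q_epi).
exists (\sum_(a < n) (sval (g a) ∘ p a : P ⟶ₖ X)).
rewrite compm_sum -[RHS]compm1 -ip compm_sum; apply: eq_bigr => a _.
by rewrite !compmA (svalP (g a)).
Qed.

Lemma semisimple_epi_split X Y (p : X ⟶ Y) : is_epi p -> exists s, p ∘ s = idm Y.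
Proof. by move=> p_epi; apply: semisimple_projective. Qed.

(** [Y] splits into the image of [f], with projector [f ∘ g], and the cokernel [Q]. Stated by
    equations, the splitting passes directly through tensor products. *)
Lemma semisimple_regular X Y (f : X ⟶ₖ Y) :
  exists Q (p : Y ⟶ₖ Q) (s : Q ⟶ₖ Y) (g : Y ⟶ₖ X),
    [/\ p ∘ f = 0 :> (X ⟶ₖ Q), p ∘ s = idm Q &
        (f ∘ g : Y ⟶ₖ Y) + (s ∘ p : Y ⟶ₖ Y) = idm Y].
Proof.
have [Q [p p_coker]] := has_cokernel f; have [pf p_univ] := p_coker.
have [s ps] := semisimple_epi_split (cokernel_epi p_coker).
have [K [i i_ker]] := has_kernel p; have [pi i_univ] := i_ker.
have [|r [ir _]] := i_univ Y ((idm Y : Y ⟶ₖ Y) - (s ∘ p : Y ⟶ₖ Y)).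
  by rewrite compmB compm1 compmA ps comp1m subrr.
have [e [ie _]] := i_univ X f pf.
have ri : r ∘ i = idm K.
  apply: (kernel_mono i_ker); rewrite compmA ir compBm -compmA pi compm0 comp1m.
  by rewrite subr0 compm1.
(* For the cokernel [q] of [e], the map [q r] kills [f], so it factors through [p]; hence
   [q = q r i] vanishes. *)
have e_epi : is_epi e.
  have [Z [q q_coker]] := has_cokernel e.
  apply: (cokernel_zero_epi q_coker).
  have [|w [wp _]] := p_univ Z (q ∘ r).
    by rewrite -ie -compmA (compmA r) ri comp1m q_coker.1.
  by rewrite -[q]compm1 -ri compmA -wp -compmA pi compm0.
have [t et] := semisimple_epi_split e_epi.
exists Q, p, s, (t ∘ r); split=> //.
by rewrite -ie -compmA (compmA e) et comp1m ir subrK.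
Qed.

End LinearCategories.

(** * Epimorphisms of modules and of underlying objects *)

Section ModuleEpimorphisms.
Local Open Scope ring_scope.
Local Open Scope cat_scope.
Variables (k : fieldType) (S : fusion_category k) (A : algebra S).
Local Notation L := (@fus_lmodule k S).
Local Notation "X ⟶ₖ Y" := (lhom L X Y) : cat_scope.

Lemma tensor_zero (X X' Y Y' : S) (g : Y ⟶ Y') :
  (0 : X ⟶ₖ X') ⊗₁ g = 0 :> (X ⊗ Y ⟶ₖ X' ⊗ Y').
Proof. exact: linear_zero ((fus_bilinear S).1 X X' Y Y' g). Qed.

Lemma tensor_add (X X' Y Y' : S) (f f' : X ⟶ₖ X') (g : Y ⟶ Y') :
  (f + f') ⊗₁ g =
  (f ⊗₁ g : X ⊗ Y ⟶ₖ X' ⊗ Y') + (f' ⊗₁ g : X ⊗ Y ⟶ₖ X' ⊗ Y') :> (X ⊗ Y ⟶ₖ X' ⊗ Y').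
Proof. exact: linear_add ((fus_bilinear S).1 X X' Y Y' g) f f'. Qed.

Section Cokernel.
Variables (M N : right_module A) (f : rmod_hom M N).
Variables (Q : S) (p : (N : S) ⟶ₖ Q) (s : Q ⟶ₖ (N : S)) (g : (N : S) ⟶ₖ (M : S)).
Hypotheses (pf : p ∘ f = 0 :> ((M : S) ⟶ₖ Q)) (ps : p ∘ s = idm Q).
Hypothesis fg_sp : (f ∘ g : (N : S) ⟶ₖ (N : S)) + (s ∘ p : (N : S) ⟶ₖ (N : S)) = idm (N : S).

Definition coker_act : Q ⊗ A ⟶ Q := locked (p ∘ rmod_act N ∘ (s ⊗₁ idm (A : S))).

(** Insert [f g + s p = 1] before acting: the summand through [f] dies because [f] is a module map
    and [p f = 0]. *)
Lemma coker_projP : p ∘ rmod_act N = coker_act ∘ (p ⊗₁ idm (A : S)).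
Proof.
rewrite /coker_act -lock -[RHS]compmA -tensorM1.
rewrite -[LHS]compm1 -tensor1 -fg_sp tensor_add (compmD (fus_linear S)).
rewrite tensorM1 !compmA -(compmA p) -(rmod_mapP f) compmA pf.
by rewrite !(comp0m (fus_linear S)) add0r.
Qed.

Lemma coker_proj1_epi (X : S) : is_epi (p ⊗₁ idm X).
Proof. by apply: (split_epi (s := s ⊗₁ idm X)); rewrite -tensorM1 ps tensor1. Qed.

Lemma coker_actA : coker_act ∘ (coker_act ⊗₁ idm (A : S)) =
  coker_act ∘ (idm Q ⊗₁ alg_mul A) ∘ associator Q A A.
Proof.
have epi2 : is_epi ((p ⊗₁ idm (A : S)) ⊗₁ idm (A : S)).
  apply: (split_epi (s := (s ⊗₁ idm (A : S)) ⊗₁ idm (A : S))).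
  by rewrite -!tensorM1 ps !tensor1.
apply: epi2; rewrite -compmA -tensorM1 -coker_projP tensorM1 compmA -coker_projP.
rewrite -compmA rmod_actA !compmA coker_projP -!compmA; congr (_ ∘ _).
by rewrite associator_nat !compmA tensor1 tensor_1l.
Qed.

Lemma coker_act1 : coker_act ∘ (idm Q ⊗₁ alg_unit A) = runitor Q.
Proof.
apply: (@coker_proj1_epi _); rewrite runitor_nat -compmA tensor_1l compmA -coker_projP.
by rewrite -compmA rmod_act1.
Qed.

Definition coker_module : right_module A := RightModule coker_actA coker_act1.

Definition coker_proj : rmod_hom N coker_module :=
  @RmodHom S A N coker_module p coker_projP.

End Cokernel.

Lemma rmod_zero_subproof (M N : right_module A) :
  (0 : (M : S) ⟶ₖ (N : S)) ∘ rmod_act M =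
  rmod_act N ∘ ((0 : (M : S) ⟶ₖ (N : S)) ⊗₁ idm (A : S)).
Proof. by rewrite (comp0m (fus_linear S)) tensor_zero (compm0 (fus_linear S)). Qed.

(** The cokernel of [f] in [S] is a quotient module, and its projection agrees with the zero map
    after [f]. So the projection vanishes, which leaves [f g = 1]. *)
Lemma rmod_epi (M N : rmod_cat A) (f : M ⟶ N) : is_epi f -> is_epi (rmod_map f).
Proof.
move=> f_epi.
have [Q [p [s [g [pf ps fg_sp]]]]] := semisimple_regular (fus_linear S) (fus_abelian S)
  (@fus_semisimple k S) (@fus_finite k S) (rmod_map f).
have p0 : p = 0.
  suff /(congr1 (@rmod_map _ _ _ _)) : coker_proj pf ps fg_sp =
    RmodHom (rmod_zero_subproof N (coker_module pf ps fg_sp)) by [].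
  apply: f_epi; apply: rmod_hom_eq => /=.
  by rewrite pf (comp0m (fus_linear S)).
have fg : rmod_map f ∘ g = idm _.
  by rewrite -fg_sp p0 (compm0 (fus_linear S)) addr0.
exact: split_epi fg.
Qed.

End ModuleEpimorphisms.

(** * Internal homs in a module category *)

Section ActionUnit.
Variables (D : monoidal_category) (N : module_category D).

Lemma act1M (X : D) (m m' m'' : N) (g : m' ⟶ m'') (f : m ⟶ m') :
  idm X ⊙₁ (g ∘ f) = (idm X ⊙₁ g) ∘ (idm X ⊙₁ f).
Proof. by rewrite -actM comp1m. Qed.

Lemma actM1 (X Y Z : D) (m : N) (g : Y ⟶ Z) (f : X ⟶ Y) :
  (g ∘ f) ⊙₁ idm m = (g ⊙₁ idm m) ∘ (f ⊙₁ idm m).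
Proof. by rewrite -actM comp1m. Qed.

Lemma act_1l (X X' : D) (m m' : N) (f : X ⟶ X') (g : m ⟶ m') :
  (idm X' ⊙₁ g) ∘ (f ⊙₁ idm m) = (f ⊙₁ idm m') ∘ (idm X ⊙₁ g).
Proof. by rewrite -!actM !comp1m !compm1. Qed.

Lemma tunit_act_inj (m m' : N) (f g : m ⟶ m') :
  idm (tunit : D) ⊙₁ f = idm (tunit : D) ⊙₁ g -> f = g.
Proof.
move=> e; apply: (iso_epi (act_unit_iso m)).
by rewrite -!act_unit_nat e.
Qed.

(** Kelly's argument, as for [lunitor_tensor]: acting by the unit object is faithful, and after it
    pentagon and triangle give the equation. *)
Lemma act_unit_tensor (X : D) (m : N) :
  act_unit (X ⊙ m) ∘ act_assoc tunit X m = lunitor X ⊙₁ idm m.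
Proof.
apply: tunit_act_inj; apply: (iso_epi (act_assoc_iso tunit (tunit ⊗ X) m)).
have a_epi : is_epi (associator (tunit : D) tunit X ⊙₁ idm m).
  apply: (split_epi (s := associator_inv (tunit : D) tunit X ⊙₁ idm m)).
  by rewrite -actM1 associatorVK act1.
apply: a_epi; rewrite act1M -!compmA (compmA (idm tunit ⊙₁ act_assoc _ _ _)).
rewrite act_pentagon compmA act_triangle -act1 -act_assoc_nat.
rewrite (compmA (idm tunit ⊙₁ (lunitor X ⊙₁ _))) -act_assoc_nat -compmA -actM1.
by rewrite triangle.
Qed.

End ActionUnit.

Section InternalEnd.
Variables (D : monoidal_category) (N : module_category D) (I : Type).
Variables (m : I -> N) (H : I -> I -> D) (ev : forall i j, H i j ⊙ m j ⟶ m i).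
Hypothesis ev_univ : forall i j (X : D) (f : X ⊙ m j ⟶ m i),
  exists! g : X ⟶ H i j, ev i j ∘ (g ⊙₁ idm (m j)) = f.

Lemma ev_inj i j (X : D) (g h : X ⟶ H i j) :
  ev i j ∘ (g ⊙₁ idm (m j)) = ev i j ∘ (h ⊙₁ idm (m j)) -> g = h.
Proof.
move=> e; have [u [_ u_uniq]] := ev_univ (ev i j ∘ (h ⊙₁ idm (m j))).
by rewrite -(u_uniq g) // -(u_uniq h).
Qed.

Definition transpose i j (X : D) (f : X ⊙ m j ⟶ m i) : X ⟶ H i j :=
  sval (cid (ev_univ f)).

Lemma transposeK i j (X : D) (f : X ⊙ m j ⟶ m i) :
  ev i j ∘ (transpose f ⊙₁ idm (m j)) = f.
Proof. by rewrite /transpose; case: cid => g []. Qed.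

(** With [H i j] read as the internal hom from [m j] to [m i], this is internal composition. *)
Definition iend_mul i j k : H i j ⊗ H j k ⟶ H i k :=
  transpose (ev i j ∘ (idm (H i j) ⊙₁ ev j k) ∘ act_assoc (H i j) (H j k) (m k)).

Definition iend_unit i : tunit ⟶ H i i := transpose (act_unit (m i)).

Lemma iend_mulE i j k :
  ev i k ∘ (iend_mul i j k ⊙₁ idm (m k)) =
  ev i j ∘ (idm (H i j) ⊙₁ ev j k) ∘ act_assoc (H i j) (H j k) (m k).
Proof. exact: transposeK. Qed.

Lemma iend_unitE i : ev i i ∘ (iend_unit i ⊙₁ idm (m i)) = act_unit (m i).
Proof. exact: transposeK. Qed.

Lemma iend_mulA i j k l :
  iend_mul i k l ∘ (iend_mul i j k ⊗₁ idm (H k l)) =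
  iend_mul i j l ∘ (idm (H i j) ⊗₁ iend_mul j k l)
    ∘ associator (H i j) (H j k) (H k l).
Proof.
apply: ev_inj; rewrite !actM1 !compmA !iend_mulE.
rewrite -!(compmA _ (act_assoc _ _ _)) !act_assoc_nat act1.
rewrite !compmA -!(compmA (ev i _) (idm _ ⊙₁ ev _ _)) act_1l -act1M iend_mulE.
rewrite !act1M (compmA (ev i k)) iend_mulE -!compmA; congr (_ ∘ (_ ∘ _)).
rewrite compmA -tensor1 act_assoc_nat -!compmA; congr (_ ∘ _).
by rewrite -act_pentagon -!compmA.
Qed.

Lemma iend_mul1m i j :
  iend_mul i i j ∘ (iend_unit i ⊗₁ idm (H i j)) = lunitor (H i j).
Proof.
apply: ev_inj; rewrite actM1 compmA iend_mulE.
rewrite -(compmA _ (act_assoc _ _ _)) act_assoc_nat act1 -!compmA.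
rewrite (compmA (idm _ ⊙₁ ev _ _)) act_1l !compmA iend_unitE act_unit_nat.
by rewrite -compmA act_unit_tensor.
Qed.

Lemma iend_mulm1 i j :
  iend_mul i j j ∘ (idm (H i j) ⊗₁ iend_unit j) = runitor (H i j).
Proof.
apply: ev_inj; rewrite actM1 compmA iend_mulE.
rewrite -(compmA _ (act_assoc _ _ _)) act_assoc_nat -!compmA.
by rewrite (compmA (idm _ ⊙₁ ev _ _)) -act1M iend_unitE act_triangle.
Qed.

Definition internal_end : enriched_category D I :=
  EnrichedCategory iend_mulA iend_mul1m iend_mulm1.

End InternalEnd.

(** * Free modules and internal homs out of the regular module *)

Section FreeModules.
Variables (D : monoidal_category) (A : algebra D).

Definition regular_module : rmod_modcat A := RightModule (alg_mulA A) (alg_mulm1 A).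

Lemma free_ev_subproof (M : right_module A) :
  rmod_act M ∘ rmod_act (rtensor M regular_module) =
  rmod_act M ∘ (rmod_act M ⊗₁ idm (A : D)).
Proof. by rewrite /= /rtensor_act compmA rmod_actA. Qed.

Definition free_ev (M : rmod_modcat A) : rmod_obj M ⊙ regular_module ⟶ M :=
  @RmodHom D A (rtensor (rmod_obj M) regular_module) M (rmod_act M)
    (free_ev_subproof M).

(** Free-forgetful adjunction: the internal hom from [A] to [M] is [M] itself, and a map out of
    [X ⊗ A] is transposed by restricting it along the unit of [A]. *)
Lemma free_ev_univ (M : rmod_modcat A) (X : D) (f : X ⊙ regular_module ⟶ M) :
  exists! g : X ⟶ rmod_obj M, free_ev M ∘ (g ⊙₁ idm regular_module) = f.
Proof.
exists (rmod_map f ∘ (idm X ⊗₁ alg_unit A) ∘ runitor_inv X); split.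
  apply: rmod_hom_eq => /=; rewrite !tensorM1 !compmA -(rmod_mapP f) /= /rtensor_act.
  rewrite compmA -(compmA _ (associator _ _ _)) associator_nat /=.
  rewrite compmA -(compmA (rmod_map f)) -tensor1M alg_mul1m -(compmA (rmod_map f)).
  by rewrite triangle -compmA -tensorM1 runitorVK tensor1 compm1.
move=> g <- /=; rewrite -!(compmA (rmod_act M)) -tensor_1l !compmA rmod_act1.
by rewrite runitor_nat -compmA runitorVK compm1.
Qed.

Lemma free_ev_epi (M : rmod_modcat A) : is_epi (free_ev M).
Proof.
move=> N g h /(congr1 (@rmod_map _ _ _ _)) /= e; apply: rmod_hom_eq.
suff M_epi : is_epi (rmod_act M) by exact: M_epi.
apply: (split_epi (s := (idm _ ⊗₁ alg_unit A) ∘ runitor_inv (rmod_obj M))).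
by rewrite compmA rmod_act1 runitorVK.
Qed.

(** Linearity of [h], stated so that universality of [free_ev] identifies the products of the Morita
    context with underlying maps of module maps. *)
Lemma free_ev_hom (X : D) (M N : rmod_modcat A) (h : X ⊙ M ⟶ N) :
  free_ev N ∘ (rmod_map h ⊙₁ idm regular_module) =
  h ∘ (idm X ⊙₁ free_ev M) ∘ act_assoc X (rmod_obj M) regular_module.
Proof. by apply: rmod_hom_eq => /=; rewrite -(rmod_mapP h) /= /rtensor_act compmA. Qed.

End FreeModules.

(** * The Morita context of an equivalence *)

(** It yields equalities of algebras rather than isomorphisms, so that Morita equivalences can be
    rewritten along them. *)
Lemma algebra_eq (D : monoidal_category) (A : algebra D) (m : A ⊗ A ⟶ A)
    (u : tunit ⟶ A) mA m1 m2 :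
  m = alg_mul A -> u = alg_unit A -> @Algebra D A m u mA m1 m2 = A.
Proof.
case: A m u mA m1 m2 => A m' u' mA' m1' m2' m u mA m1 m2 /= em eu.
move: mA m1 m2; rewrite em eu => mA m1 m2.
by rewrite (Prop_irrelevance mA mA') (Prop_irrelevance m1 m1') (Prop_irrelevance m2 m2').
Qed.

(** Essential surjectivity moves the target of two test maps into the image of [F]; fullness then
    lifts them to maps out of [Y]. *)
Lemma weak_equivalence_epi (C D : category) (F : functor C D) (X Y : C) (f : X ⟶ Y) :
  weak_equivalence F -> is_epi f -> is_epi (fmap F f).
Proof.
move=> [ff es] f_epi W g h e; have [Z [t t_iso]] := es W.
apply: (iso_mono (iso_inv_iso t_iso)).
rewrite -(ff_liftK ff (_ ∘ g)) -(ff_liftK ff (_ ∘ h)); congr fmap.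
apply: f_epi; apply: (ff_faithful ff).
by rewrite !fmapM !ff_liftK -!compmA e.
Qed.

Lemma faithful_reflects_epi (C D : category) (F : functor C D) (X Y : C) (f : X ⟶ Y) :
  fully_faithful F -> is_epi (fmap F f) -> is_epi f.
Proof.
move=> ff f_epi Z g h e; apply: (ff_faithful ff); apply: f_epi.
by rewrite -!fmapM e.
Qed.

(** * Transport of internal homs along a module functor *)

Section Transport.
Variables (D : monoidal_category) (M N : module_category D) (F : module_functor M N).

Definition mod_act_inv X (m : M) : X ⊙ F m ⟶ F (X ⊙ m) := iso_inv (mod_act_iso F X m).

Lemma mod_act_inv_nat (X X' : D) (m m' : M) (f : X ⟶ X') (g : m ⟶ m') :
  mod_act_inv X' m' ∘ (f ⊙₁ fmap F g) = fmap F (f ⊙₁ g) ∘ mod_act_inv X m.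
Proof.
apply: (iso_mono (mod_act_iso F X' m')); rewrite !compmA iso_invVK comp1m.
by rewrite mod_act_nat -compmA iso_invVK compm1.
Qed.

(** An evaluation [h] is transported to [fmap F h] after the inverse structure map; associativity of
    [mod_act] makes this respect nested evaluation. *)
Lemma transport_comp (X Y : D) (r n n' : M) (h' : X ⊙ n ⟶ n') (h : Y ⊙ r ⟶ n) :
  fmap F h' ∘ mod_act_inv X n ∘ (idm X ⊙₁ (fmap F h ∘ mod_act_inv Y r))
    ∘ act_assoc X Y (F r) =
  fmap F (h' ∘ (idm X ⊙₁ h) ∘ act_assoc X Y r) ∘ mod_act_inv (X ⊗ Y) r.
Proof.
apply: (iso_epi (mod_act_iso F (X ⊗ Y) r)).
rewrite -!compmA -mod_act_assoc iso_invK compm1 act1M !fmapM -!compmA.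
congr (_ ∘ _); rewrite (compmA (mod_act_inv X n)) mod_act_inv_nat -!compmA.
congr (_ ∘ _); rewrite (compmA (idm X ⊙₁ mod_act_inv Y r)) -act1M iso_invK act1 comp1m.
by rewrite compmA iso_invK comp1m.
Qed.

Lemma transport_tensor (X Y : D) (r n : M) (h : Y ⊙ r ⟶ n) (f : X ⟶ Y) :
  fmap F h ∘ mod_act_inv Y r ∘ (f ⊙₁ idm (F r)) =
  fmap F (h ∘ (f ⊙₁ idm r)) ∘ mod_act_inv X r.
Proof. by rewrite -fmap1 -compmA mod_act_inv_nat fmapM -!compmA. Qed.

(** Maps [X ⊙ F r ⟶ n'] correspond to maps [F (X ⊙ r) ⟶ F n], hence to maps [X ⊙ r ⟶ n]. The
    isomorphism [t] allows targets only isomorphic to a value of [F]. *)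
Lemma transport_univ (r n : M) (n' : N) (t : F n ⟶ n') (Y : D) (h : Y ⊙ r ⟶ n) :
  fully_faithful F -> is_iso t ->
  (forall (X : D) (f : X ⊙ r ⟶ n), exists! g : X ⟶ Y, h ∘ (g ⊙₁ idm r) = f) ->
  forall (X : D) (f : X ⊙ F r ⟶ n'),
    exists! g : X ⟶ Y, t ∘ fmap F h ∘ mod_act_inv Y r ∘ (g ⊙₁ idm (F r)) = f.
Proof.
move=> ff t_iso h_univ X f.
have [g [gE g_uniq]] := h_univ X (ff_lift ff (iso_inv t_iso ∘ f ∘ mod_act F X r)).
exists g; split=> [|g' g'E].
  rewrite -!(compmA t) transport_tensor gE ff_liftK !compmA iso_invVK comp1m -compmA.
  by rewrite iso_invVK compm1.
apply: g_uniq; apply: (ff_faithful ff); rewrite ff_liftK -g'E -!(compmA t) transport_tensor.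
by rewrite !compmA iso_invK comp1m -compmA iso_invK compm1.
Qed.

End Transport.

Section MoritaContext.
Variables (k : fieldType) (S : fusion_category k) (A A' : algebra S).
Variable F : module_functor (rmod_modcat A) (rmod_modcat A').
Hypothesis ff : fully_faithful F.
Hypothesis F_epi : forall (M N : rmod_modcat A) (f : M ⟶ N),
  is_epi f -> is_epi (fmap F f).
Variable Q : rmod_modcat A.
Local Notation R := (regular_module A).
Local Notation R' := (regular_module A').
Variable phi : F Q ⟶ R'.
Hypothesis phi_iso : is_iso phi.

(** Index [false] stands for [A] and [true] for [A']; [mctx_iso] compares the image of this object
    under [F] with [mctx_tgt]. *)
Definition mctx_src (i : bool) : rmod_modcat A := if i then Q else R.

Definition mctx_tgt (i : bool) : rmod_modcat A' := if i then R' else F R.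

Definition mctx_iso (i : bool) : F (mctx_src i) ⟶ mctx_tgt i :=
  match i return F (mctx_src i) ⟶ mctx_tgt i with
  | true => phi
  | false => idm (F R)
  end.

Lemma mctx_iso_iso i : is_iso (mctx_iso i).
Proof. by case: i => //; apply: is_iso_id. Qed.

(** The internal hom from [mctx_tgt j] to [mctx_tgt i], read off over [A'] when the source is [R']
    and over [A] when it is [F R]. This makes the diagonal entries convertible to [A'] and [A]; the
    others are [P] ([false], [true]) and [Q] ([true], [false]). *)
Definition mctx_hom (i j : bool) : S :=
  if j then rmod_obj (mctx_tgt i) else rmod_obj (mctx_src i).

Definition mctx_ev (i j : bool) : mctx_hom i j ⊙ mctx_tgt j ⟶ mctx_tgt i :=
  match j return mctx_hom i j ⊙ mctx_tgt j ⟶ mctx_tgt i with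
  | true => free_ev (mctx_tgt i)
  | false => mctx_iso i ∘ fmap F (free_ev (mctx_src i)) ∘ mod_act_inv F _ R
  end.

Lemma mctx_ev_univ i j (X : S) (f : X ⊙ mctx_tgt j ⟶ mctx_tgt i) :
  exists! g : X ⟶ mctx_hom i j, mctx_ev i j ∘ (g ⊙₁ idm (mctx_tgt j)) = f.
Proof.
case: j f => f; first exact: free_ev_univ.
apply: transport_univ ff (mctx_iso_iso i) _ X f => X f; exact: free_ev_univ.
Qed.

Definition mctx : enriched_category S bool := internal_end mctx_ev_univ.

(** Product and unit are determined by their evaluation equations, which those of [A'] satisfy
    too. *)
Lemma mctx_alg_true : end_algebra mctx true = A'.
Proof.
apply: algebra_eq.
  apply: (ev_inj mctx_ev_univ (i := true) (j := true)); rewrite iend_mulE; symmetry.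
  exact: (free_ev_hom (mctx_ev true true)).
apply: (ev_inj mctx_ev_univ (i := true) (j := true)); rewrite iend_unitE; symmetry.
by apply: rmod_hom_eq; apply: alg_mul1m.
Qed.

Lemma mctx_evE : mctx_ev false false =
  fmap F (free_ev R) ∘ mod_act_inv F (A : S) R.
Proof. by congr (_ ∘ _); apply: comp1m. Qed.

Lemma mctx_alg_false : end_algebra mctx false = A.
Proof.
apply: algebra_eq.
  apply: (ev_inj mctx_ev_univ (i := false) (j := false)); rewrite iend_mulE; symmetry.
  rewrite mctx_evE.
  (* Both sides are transports of maps [(A ⊗ A) ⊙ R ⟶ R], which agree by associativity of [A]. *)
  rewrite [LHS]transport_tensor; apply: etrans (esym (transport_comp F _ _)).
  congr (fmap F _ ∘ _); apply: rmod_hom_eq; exact: alg_mulA.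
apply: (ev_inj mctx_ev_univ (i := false) (j := false)); rewrite iend_unitE; symmetry.
rewrite mctx_evE [LHS]transport_tensor.
apply: (iso_epi (mod_act_iso F tunit R)); rewrite -compmA iso_invK compm1.
rewrite [RHS]mod_act_unit; congr (fmap F _).
by apply: rmod_hom_eq; apply: alg_mul1m.
Qed.

(** The product [Q ⊗ P ⟶ A'] thus underlies a module map, which puts it in reach of [rmod_epi]. *)
Lemma mctx_mul_tft : emul mctx true false true = rmod_map (mctx_ev true false).
Proof.
apply: (ev_inj mctx_ev_univ (i := true) (j := true)); rewrite iend_mulE; symmetry.
exact: (free_ev_hom (mctx_ev true false)).
Qed.

Lemma mctx_mul_tft_epi : is_epi (emul mctx true false true).
Proof.
rewrite mctx_mul_tft.
suff ev_epi : is_epi (mctx_ev true false) by exact: (rmod_epi ev_epi).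
apply: is_epi_comp; last first.
  by apply: iso_epi; apply: iso_inv_iso.
apply: is_epi_comp; first exact: iso_epi.
by apply: F_epi; apply: free_ev_epi.
Qed.

(** The product [P ⊗ Q ⟶ A] as a module map: [F] sends it to the evaluation of [P = F R] on [R'],
    with [R'] replaced by [F Q] along [phi]. *)
Definition mctx_tau : rmod_obj (F R) ⊙ Q ⟶ R :=
  ff_lift ff (free_ev (F R) ∘ (idm _ ⊙₁ phi) ∘ mod_act F (rmod_obj (F R)) Q).

Lemma mctx_mul_ftf : emul mctx false true false = rmod_map mctx_tau.
Proof.
apply: (ev_inj mctx_ev_univ (i := false) (j := false)); rewrite iend_mulE; symmetry.
rewrite mctx_evE [LHS]transport_tensor (free_ev_hom mctx_tau).
rewrite -(transport_comp F mctx_tau (free_ev Q)).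
congr (_ ∘ _); rewrite ff_liftK -(compmA _ (mod_act _ _ _)) iso_invVK compm1.
rewrite -(compmA (free_ev (F R))) -act1M.
by congr (_ ∘ (_ ⊙₁ _)); rewrite compmA.
Qed.

Lemma mctx_mul_ftf_epi : is_epi (emul mctx false true false).
Proof.
rewrite mctx_mul_ftf.
suff tau_epi : is_epi mctx_tau by exact: (rmod_epi tau_epi).
apply: (faithful_reflects_epi ff).
rewrite ff_liftK; apply: is_epi_comp; last by apply: iso_epi; apply: mod_act_iso.
apply: is_epi_comp; first exact: free_ev_epi.
by apply: iso_epi; apply: act1_iso.
Qed.

End MoritaContext.

(** * Lax monoidal functors *)

Section LaxEnriched.
Variables (C D : monoidal_category) (F : lax_monoidal_functor C D) (I : Type).
Variable E : enriched_category C I.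

Definition lax_emul i j k : F (E i j) ⊗ F (E j k) ⟶ F (E i k) :=
  fmap F (emul E i j k) ∘ lax_mul F (E i j) (E j k).

Definition lax_eunit i : tunit ⟶ F (E i i) := fmap F (eunit E i) ∘ lax_unit F.

Lemma lax_emulA i j k l :
  lax_emul i k l ∘ (lax_emul i j k ⊗₁ idm (F (E k l))) =
  lax_emul i j l ∘ (idm (F (E i j)) ⊗₁ lax_emul j k l)
    ∘ associator (F (E i j)) (F (E j k)) (F (E k l)).
Proof.
rewrite /lax_emul tensorM1 tensor1M -!compmA -fmap1.
rewrite (compmA (lax_mul F (E i k) _)) lax_mul_nat -fmap1.
rewrite (compmA (lax_mul F (E i j) _)) lax_mul_nat -!compmA !fmap1.
rewrite (compmA (lax_mul F (E i j) _)) -lax_mulA !compmA -!fmapM.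
by rewrite emulA.
Qed.

Lemma lax_emul1m i j :
  lax_emul i i j ∘ (lax_eunit i ⊗₁ idm (F (E i j))) = lunitor (F (E i j)).
Proof.
rewrite /lax_emul /lax_eunit tensorM1 -fmap1 -!compmA.
rewrite (compmA (lax_mul F _ _)) lax_mul_nat !compmA -fmapM emul1m fmap1.
exact: lax_mul1m.
Qed.

Lemma lax_emulm1 i j :
  lax_emul i j j ∘ (idm (F (E i j)) ⊗₁ lax_eunit j) = runitor (F (E i j)).
Proof.
rewrite /lax_emul /lax_eunit tensor1M -fmap1 -!compmA.
rewrite (compmA (lax_mul F _ _)) lax_mul_nat !compmA -fmapM emulm1 fmap1.
exact: lax_mulm1.
Qed.

Definition lax_enriched : enriched_category D I :=
  EnrichedCategory lax_emulA lax_emul1m lax_emulm1.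

(** Carrier, product and unit agree by computation; only the proofs of the axioms may differ. *)
Lemma lax_end_algebra i :
  end_algebra lax_enriched i = lax_algebra F (end_algebra E i).
Proof. exact: (@algebra_eq D (lax_algebra F (end_algebra E i))). Qed.

End LaxEnriched.

Theorem theorem4p1 (k : closedFieldType) (char0 : [pchar k]%R =i pred0)
  (S T : fusion_category k) (Gamma : lax_monoidal_functor S T)
  (Gamma_epi : preserves_epis Gamma)
  (Gamma_mul_epi : forall X Y : S, is_epi (lax_mul Gamma X Y))
  (A A' : algebra S) :
  morita_equivalent A A' ->
  morita_equivalent (lax_algebra Gamma A) (lax_algebra Gamma A').
Proof.
case=> F /equivalence_weak weF; have [ff es] := weF.
have [Q [phi phi_iso]] := es (regular_module A').
have F_epi M N (f : M ⟶ N) : is_epi f -> is_epi (fmap F f).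
  exact: weak_equivalence_epi.
pose E := mctx ff phi_iso.
suff: morita_equivalent (end_algebra (lax_enriched Gamma E) false)
    (end_algebra (lax_enriched Gamma E) true).
  by rewrite !lax_end_algebra mctx_alg_false mctx_alg_true.
apply: enriched_morita.
  exact: abelian_idempotent_complete (fus_linear T) (fus_abelian T).
have epiE i j : is_epi (emul E i j i).
  (* Diagonal products are split by the unit; the other two are the pairings of the Morita
     context. *)
  case: (eqVneq i j) => [<-|].
    apply: (split_epi (s := (idm _ ⊗₁ eunit E i) ∘ runitor_inv _)).
    by rewrite compmA emulm1 runitorVK.
  case: i j => [] [] // _; rewrite /E.
    by have := @mctx_mul_tft_epi _ _ _ _ _ ff F_epi _ _ phi_iso.
  by have := @mctx_mul_ftf_epi _ _ _ _ _ ff _ _ phi_iso.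
(* The unit object of [T] is projective, so each unit lifts along the product, an epimorphism by
   both hypotheses on [Gamma]. *)
move=> i j; apply: (semisimple_projective (fus_linear T) (fus_abelian T)
  (@fus_semisimple k T) (@fus_finite k T)).
by apply: is_epi_comp; [apply: Gamma_epi; apply: epiE | apply: Gamma_mul_epi].
Qed.
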